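(* Let $H$ be a finite group and let $\Gamma=\mathrm{LSG}(H)$ be the latin square graph of the Cayley table of $H$. (i) If there is a subgroup $G$ of the group of autoparatopisms of the Cayley table of $H$ such that $\Gamma$ is $G$-arc-transitive and $G$-quotient-complete, then $H$ is elementary abelian, $H\cong C_p^d$ for some prime $p$ and positive integer $d$, and at least one of the following holds: $p\not\equiv 2 \pmod 3$; $d$ is even; $d\equiv 0\pmod 3$. (ii) If $H\cong C_p^d$ with $p$ prime and $d$ a positive integer satisfying none of these three conditions, and $G$ is a subgroup of autoparatopisms such that $\Gamma$ is $G$-arc-transitive, then $\Gamma$ is $G$-vertex-quasiprimitive. (iii) Conversely, for every $H= C_p^d$ ($p$ prime, $d\ge 1$) satisfying at least one of the three conditions in (i), there exists a subgroup $G$ of autoparatopisms of the Cayley table of $H$ such that $\Gamma$ is $G$-arc-transitive and $G$-quotient-complete.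
   Context: For a finite group $H$, the Cayley table of $H$ is viewed as the latin square $L=\{(a,b,ab): a,b\in H\}\subseteq H^3$. The latin square graph $\mathrm{LSG}(H)$ has vertex set $L$, two triples being adjacent iff they agree in exactly one coordinate. An autoparatopism of $L$ is an element of $\mathrm{Sym}(H)\wr \mathrm{Sym}(3)$, in its product action on $H^3$ (permutations applied in each coordinate followed by a permutation of the three coordinates), that preserves $L$ setwise; each autoparatopism induces an automorphism of $\mathrm{LSG}(H)$. For a graph $\Gamma$ and a group $G\le \mathrm{Aut}(\Gamma)$: $\Gamma$ is $G$-arc-transitive if $G$ is transitive on ordered pairs of adjacent vertices. For $N\trianglelefteq G$, the $G$-normal quotient $\Gamma_N$ has as vertices the $N$-orbits on vertices of $\Gamma$, two distinct orbits being adjacent iff some vertex of one is adjacent in $\Gamma$ to some vertex of the other. A normal quotient $\Gamma_N$ is proper if $N\ne 1$, and nontrivial if $N\neq 1$ and $N$ is intransitive on vertices. $\Gamma$ is $G$-quotient-complete if every proper $G$-normal quotient of $\Gamma$ is complete or empty (has no edges) and $\Gamma$ has at least one nontrivial complete $G$-normal quotient. $\Gamma$ is $G$-vertex-quasiprimitive if every nontrivial normal subgroup of $G$ is transitive on the vertices of $\Gamma$. *)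

(* Defs.v *)
From HB Require Import structures.
From mathcomp Require Import all_boot all_fingroup all_algebra all_solvable.

Set Implicit Arguments.
Unset Strict Implicit.
Unset Printing Implicit Defensive.

Local Open Scope group_scope.

Section Graphs.

Variable V : finType.
Implicit Types (e : rel V) (X : {set V}) (G N : {group {perm V}}).

Definition graph_aut e : {set {perm V}} :=
  [set s : {perm V} | [forall x, forall y, e (s x) (s y) == e x y]].

(* Not stated with [transitive _, on _ | _], which is false on an empty set:
   an edgeless graph is arc-transitive for every group. *)
Definition arc_transitive e G : Prop :=
  forall x y x' y' : V, e x y -> e x' y' ->
    exists2 s : {perm V}, s \in G & s x = x' /\ s y = y'.

Definition complete_on (T : finType) (X : {set T}) (e : rel T) : Prop :=
  {in X &, forall x y, x != y -> e x y}.

Definition empty_on (T : finType) (X : {set T}) (e : rel T) : Prop :=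
  {in X &, forall x y, ~~ e x y}.

Definition quotient_vertices N : {set {set V}} :=
  [set orbit 'P N x | x in [set: V]].

Definition quotient_adj e : rel {set V} :=
  fun A B => (A != B) && [exists x in A, exists y in B, e x y].

Definition complete_quotient e N : Prop :=
  complete_on (quotient_vertices N) (quotient_adj e).

Definition empty_quotient e N : Prop :=
  empty_on (quotient_vertices N) (quotient_adj e).

Definition quotient_complete e G : Prop :=
  (forall N, N <| G -> N :!=: 1 ->
     complete_quotient e N \/ empty_quotient e N)
  /\
  (exists N : {group {perm V}},
     [/\ N <| G, N :!=: 1, ~~ [transitive N, on [set: V] | 'P]
       & complete_quotient e N]).

Definition vertex_quasiprimitive G : Prop :=
  forall N, N <| G -> N :!=: 1 -> [transitive N, on [set: V] | 'P].

End Graphs.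

Section LatinSquare.

Variable gT : finGroupType.

Definition cayley_table : {set 3.-tuple gT} :=
  [set [tuple a; b; a * b] | a in [set: gT], b in [set: gT]].

Definition cell : finType := {x : 3.-tuple gT | x \in cayley_table}.

Definition LSG : rel cell := fun x y =>
  #|[set i : 'I_3 | tnth (val x) i == tnth (val y) i]| == 1%N.

(* The element (f, s) of Sym(H) wr Sym(3): f i is applied to the i-th entry,
   and the result is moved to position s i. *)
Definition product_action (f : {ffun 'I_3 -> {perm gT}}) (s : 'S_3)
    (x : 3.-tuple gT) : 3.-tuple gT :=
  [tuple f (s^-1 i) (tnth x (s^-1 i)) | i < 3].

Definition autoparatopism : {set {perm 3.-tuple gT}} :=
  [set t : {perm 3.-tuple gT} |
     [exists f, exists s, forall x, t x == product_action f s x]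
     && (t @: cayley_table == cayley_table)].

Lemma autoparatopism_group_set : group_set autoparatopism.
Proof.
apply/group_setP; split=> [|t u].
  rewrite inE; apply/andP; split; last first.
    by apply/eqP; rewrite (eq_imset _ (@perm1 _)) imset_id.
  apply/existsP; exists [ffun=> 1]; apply/existsP; exists 1; apply/forallP=> x.
  apply/eqP/eq_from_tnth => i.
  by rewrite tnth_mktuple invg1 !perm1 ffunE perm1.
rewrite !inE => /andP[/existsP[f /existsP[s /forallP Et]] /eqP Lt].
move=> /andP[/existsP[g /existsP[r /forallP Eu]] /eqP Lu].
apply/andP; split; last first.
  by apply/eqP; rewrite (eq_imset _ (permM t u)) imset_comp Lt Lu.
apply/existsP; exists [ffun i => f i * g (s i)].
apply/existsP; exists (s * r); apply/forallP=> x.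
apply/eqP/eq_from_tnth => i.
rewrite permM (eqP (Eu _)) (eqP (Et _)) !tnth_mktuple invMg !permM ffunE.
by rewrite permM permKV.
Qed.
Canonical autoparatopism_group := Group autoparatopism_group_set.

(* The image of a group of permutations of H^3 stabilising the Cayley table
   in the symmetric group on the vertices of the latin square graph. *)
Definition induced_group (G : {group {perm 3.-tuple gT}}) :
    {group {perm cell}} :=
  (actperm (subaction cell 'P) @* G)%G.

Lemma autoparatopism_dom :
  autoparatopism \subset subact_dom (mem cayley_table) 'P.
Proof.
apply/subsetP=> t; rewrite inE => /andP[_ /eqP Lt].
rewrite !inE /=; apply/subsetP=> x; rewrite !inE => Lx.
by rewrite -Lt; apply: imset_f.
Qed.

Lemma induced_group_aut (G : {group {perm 3.-tuple gT}}) :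
  G \subset autoparatopism -> induced_group G \subset graph_aut LSG.
Proof.
move=> sGA; apply/subsetP=> _ /morphimP[t Dt Gt ->].
have := subsetP sGA t Gt.
rewrite !inE => /andP[/existsP[f /existsP[s /forallP Et]] _].
apply/forallP=> x; apply/forallP=> y; apply/eqP.
rewrite /LSG !actpermE /= !val_subact Dt /= !apermE !(eqP (Et _)).
congr (_ == _); rewrite -[RHS](card_imset _ (@perm_inj _ s)).
apply: eq_card => i; rewrite -[i](permKV s) mem_imset; last exact: perm_inj.
by rewrite !inE !tnth_mktuple permK (inj_eq perm_inj).
Qed.

End LatinSquare.

(* For p prime, 'rV['F_p]_d is the direct power of d copies of Z/p, its group
   law being the addition of row vectors. *)
Definition is_Cp_power (gT : finGroupType) (p d : nat) : bool :=
  [set: gT] \isog [set: 'rV['F_p]_d].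

Definition arithmetic_condition (p d : nat) : Prop :=
  [\/ p <> 2 %[mod 3], ~~ odd d | d = 0 %[mod 3]].

(* Main.v *)
(* Write the vertices in the symmetric form {(a, b, c) | a b c = 1} and let o be
   the vertex (1, 1, 1).  An autoparatopism fixing o acts by one (anti)automorphism
   of H on all three coordinates, followed by a permutation of the coordinates.
   Arc-transitivity therefore makes all nonidentity elements of H of the same order
   and, the centre of a p-group being nontrivial, central.

   If N is an intransitive nontrivial normal subgroup of G then the N-orbit of o
   contains no neighbour of o.  So each coordinate is injective on it, and a count
   shows that it has |H| = q = p^d points: every N-orbit meets every line, and the
   quotient is complete.

   Suppose that p = 2 mod 3, d is odd and 3 does not divide d; then 3 divides
   neither d nor q - 1.  If d > 1, take a primitive prime divisor r of p^d - 1 and a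
   Sylow r-subgroup Q of the group of automorphisms of H induced by elements of the
   stabiliser of o that fix each coordinate.  The normaliser of Q in
   Aut H = GL_d(p) is contained in GammaL_1(q), of order (q - 1)d, so has no element
   of order 3; if d = 1, neither has Aut H, of order p - 1.  By the Frattini argument
   the stabiliser of o contains a pure 3-cycle of the coordinates.  It fixes a point
   (a, a, a) with a <> 1 of the N-orbit of o, which has q - 1 = 1 mod 3 points other
   than o.  As p <> 3, this contradicts a^3 = 1.

   Otherwise identify H with the field F of order q and choose a line F (w0, w1, w2)
   of the plane of sum zero which is stable under a semilinear cyclic shift: either
   w = (1, z, z^2) with 1 + z + z^2 = 0, or w = (u, u^s, u^(s^2)) with u of trace
   zero and s a field automorphism of order 3.  Then G is the group of all
   autoparatopisms permuting the cosets of this line. *)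
Require Import Defs.
From mathcomp Require Import all_boot all_order all_fingroup all_algebra all_solvable.
From mathcomp Require Import all_field all_character zify ring.

Set Implicit Arguments.
Unset Strict Implicit.
Unset Printing Implicit Defensive.

(** * Primitive prime divisors *)

Section CyclotomicValues.
Import Order.TTheory GRing.Theory Num.Theory.
Local Open Scope ring_scope.

Lemma perm_divisors_mul (l m : nat) : prime l -> (0 < m)%N ->
  perm_eq (divisors (l * m))
    ([seq l * e | e <- divisors m]%N ++ [seq e <- divisors m | ~~ (l %| e)%N]).
Proof.
move=> pr_l m_gt0; have l_gt0 := prime_gt0 pr_l.
apply: uniq_perm; first exact: divisors_uniq.
  rewrite cat_uniq filter_uniq ?divisors_uniq // map_inj_uniq ?divisors_uniq.
    rewrite andbT /=; apply/hasPn => e; rewrite mem_filter => /andP[l'e _].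
    by apply: contra l'e => /mapP[k _ ->]; rewrite dvdn_mulr.
  by move=> i j /eqP; rewrite eqn_pmul2l // => /eqP.
move=> e; rewrite mem_cat mem_filter -!dvdn_divisors ?muln_gt0 ?l_gt0 //.
apply/idP/idP => [dv_e|/orP[/mapP[k]|]]; last 2 first.
- by rewrite -dvdn_divisors // => dv_k ->; rewrite dvdn_pmul2l.
- by case/andP=> _ /dvdn_mull->.
have [/dvdnP[k Dk] | l'e] /= := boolP (l %| e)%N.
  rewrite Dk mulnC in dv_e *; rewrite orbF map_f // -dvdn_divisors //.
  by rewrite dvdn_pmul2l in dv_e.
by rewrite orbC -(@Gauss_dvdr _ l) ?dv_e // coprime_sym prime_coprime.
Qed.

Lemma prod_Cyclotomic_eval (n : nat) (y : int) : (0 < n)%N ->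
  \prod_(e <- divisors n) ('Phi_e).[y] = y ^+ n - 1.
Proof.
by move=> n_gt0; rewrite -horner_prod prod_Cyclotomic // !hornerE.
Qed.

(** Taken over all divisors of m, the products of the two sides both equal y^(lm) - 1. By induction
    the factors at proper divisors agree, and they cancel because y > 1 makes them nonzero. *)
Lemma Cyclotomic_mul_prime (l m : nat) (y : int) : prime l -> (0 < m)%N ->
    1 < y ->
  ('Phi_(l * m)).[y] * (if (l %| m)%N then 1 else ('Phi_m).[y])
    = ('Phi_m).[y ^+ l].
Proof.
move=> pr_l; elim/ltn_ind: m => m IHm m_gt0 y_gt1.
have l_gt0 := prime_gt0 pr_l.
pose L e := ('Phi_(l * e)).[y] * (if (l %| e)%N then 1 else ('Phi_e).[y]).
have: \prod_(e <- divisors m) L e = \prod_(e <- divisors m) ('Phi_e).[y ^+ l].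
  rewrite prod_Cyclotomic_eval // -exprM -prod_Cyclotomic_eval ?muln_gt0 ?l_gt0 //.
  rewrite (perm_big _ (perm_divisors_mul pr_l m_gt0)) big_cat big_map big_filter.
  rewrite big_split /=; congr (_ * _); rewrite [RHS]big_mkcond /=.
  by apply: eq_bigr => e _; case: ifP.
have m_in : m \in divisors m by rewrite -dvdn_divisors.
rewrite !(big_rem m m_in) /= {1}/L.
suffices ->: \prod_(e <- rem m (divisors m)) L e
    = \prod_(e <- rem m (divisors m)) ('Phi_e).[y ^+ l].
  apply: mulIf; apply/eqP=> P0.
  have := prod_Cyclotomic_eval (y ^+ l) m_gt0.
  rewrite (big_rem m m_in) /= P0 mulr0 => /esym/eqP; rewrite subr_eq0 -exprM.
  by rewrite pexprn_eq1 ?muln_eq0 ?negb_or -?lt0n ?l_gt0 ?ltW //; lia.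
apply: eq_big_seq => e; rewrite mem_rem_uniq ?divisors_uniq // !inE.
rewrite -dvdn_divisors // => /andP[ne_em dv_em].
apply: IHm => //; first by rewrite ltn_neqAle ne_em dvdn_leq.
exact: dvdn_gt0 dv_em.
Qed.

Lemma norm_Cyclotomic (n : nat) (z : algC) (y : int) : n.-primitive_root z ->
  `|('Phi_n).[y]|%:~R = \prod_(k < n | coprime k n) `|y%:~R - z ^+ k| :> algC.
Proof.
move=> prim_z; rewrite intr_norm -horner_map /= (Cintr_Cyclotomic prim_z).
rewrite /cyclotomic horner_prod normr_prod.
by apply: eq_bigr => k _; rewrite !hornerE.
Qed.

(** Factor the values of ['Phi_m] at p^l and at p over the primitive m-th roots of unity. Each
    factor of the first is more than l times the matching factor of the second, and the two values
    are linked by [Cyclotomic_mul_prime]. *)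
Lemma Cyclotomic_gt_prime (l m p : nat) : prime l -> (4 < l)%N -> (0 < m)%N ->
  (1 < p)%N -> (l%:Z < `|('Phi_(l * m)).[p%:Z]|).
Proof.
move=> pr_l l_gt4 m_gt0 p_gt1; rewrite ltNge; apply/negP => le_l.
have [z prim_z] := C_prim_root_exists m_gt0.
have zk k : `|z ^+ k| = 1.
  have /eqP := congr1 Num.norm (prim_expr_order prim_z).
  rewrite normrX normr1 pexprn_eq1 // -[m == _]negbK -lt0n m_gt0 => /eqP z1.
  by rewrite normrX z1 expr1n.
pose a (k : 'I_m) := `|(p%:Z ^+ l)%:~R - z ^+ k| : algC.
pose b (k : 'I_m) := `|(p%:Z)%:~R - z ^+ k| : algC.
have b_ge0 k : 0 <= b k by exact: normr_ge0.
have b_ge k : 1 <= b k.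
  apply: le_trans (lerB_dist _ _); rewrite zk -pmulrn normr_nat.
  by rewrite lerBrDl -(natrD _ 1 1) ler_nat.
(* The triangle inequality reduces this to l(p + 1) < p^l - 1, which fails for p = 2 and l = 2,
   3. *)
have ab k : l%:R * b k < a k.
  apply: le_lt_trans (_ : l%:R * (p.+1)%:R < _).
    apply: ler_wpM2l; first exact: ler0n.
    apply: le_trans (ler_normB _ _) _.
    by rewrite zk -pmulrn normr_nat -natr1.
  apply: lt_le_trans (lerB_dist _ _); rewrite zk -natrM.
  rewrite rmorphXn /= -pmulrn -natrX normr_nat ltrBrDl -(natrD _ 1) ltr_nat add1n.
  have pl: (2 ^ l.-1 * p <= p ^ l)%N.
    by rewrite -[X in (_ <= p ^ X)%N](prednK (prime_gt0 pr_l)) expnSr leq_mul2r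
      leq_exp2r ?p_gt1 ?orbT //; lia.
  have l2 : (l * 3 + 2 < 2 ^ l.-1 * 2)%N.
    rewrite -expnSr prednK ?prime_gt0 //; move: l_gt4; clear.
    elim: l => // l IH; rewrite ltnS leq_eqVlt => /predU1P[<- // | /IH].
    by rewrite expnS; lia.
  nia.
(* The products are nonempty: the index is 1 modulo m, so that m = 1 is covered too. One factor l is
   spent on this index. *)
pose k0 : 'I_m := Ordinal (ltn_pmod 1 m_gt0).
have co_k0 : coprime k0 m by rewrite /= coprime_modl coprime1n.
have := @Cyclotomic_mul_prime l m p%:Z pr_l m_gt0 p_gt1.
move/(congr1 (fun x : int => `|x|%:~R : algC)); rewrite normrM intrM.
rewrite [RHS](norm_Cyclotomic _ prim_z) => Dprod.
suffices: \prod_(k < m | coprime k m) a k <= l%:R * \prod_(k < m | coprime k m) b k.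
  rewrite lt_geF //.
  apply: le_lt_trans (_ : \prod_(k < m | coprime k m) (l%:R * b k) < _).
    rewrite (bigD1 k0) //= [leRHS](bigD1 k0) //= mulrA ler_wpM2l ?mulr_ge0 ?b_ge0 ?ler0n //.
    apply: ler_prod => k _.
    by rewrite b_ge0 ler_peMl ?b_ge0 ?ler1n ?prime_gt0.
  apply: ltr_prod => [|k _]; last by rewrite ab mulr_ge0 ?b_ge0 ?ler0n.
  by apply/hasP; exists k0; rewrite ?mem_index_enum.
rewrite -Dprod -(norm_Cyclotomic _ prim_z).
have le_lC : `|('Phi_(l * m)).[p%:Z]|%:~R <= l%:R :> algC.
  by rewrite [leRHS]pmulrn ler_int.
(* If l divides m, the factor ['Phi_m] at p is missing from the left side, but it is at least 1 in
   absolute value. *)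
have [_|_] := ifP; last by apply: ler_wpM2r; rewrite ?ler0z.
rewrite normr1 mulr1 -[leLHS]mulr1; apply: ler_pM => //.
rewrite (norm_Cyclotomic _ prim_z).
elim/big_ind: _ => [//|x y x1 y1|k _]; last exact: b_ge.
by rewrite -[1]mulr1; apply: ler_pM.
Qed.

End CyclotomicValues.

Section Zsigmondy.
Import Order.TTheory GRing.Theory Num.Theory.
Local Open Scope nat_scope.

Lemma dvdn_expB1 (r p a : nat) : 0 < p -> (r %| p ^ a - 1) = (p ^ a == 1 %[mod r]).
Proof. by move=> p_gt0; rewrite eqn_mod_dvd // expn_gt0 p_gt0. Qed.

Lemma dvdn_expB1_gcd (r p a b : nat) : 0 < p -> 0 < a ->
  r %| p ^ a - 1 -> r %| p ^ b - 1 -> r %| p ^ gcdn a b - 1.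
Proof.
move=> p_gt0 a_gt0; rewrite !dvdn_expB1 // => /eqP pa1 /eqP pb1.
case: (egcdnP b a_gt0) => km kn Dab _; apply/eqP.
have: p ^ (km * a) = 1 %[mod r] by rewrite (mulnC km) expnM -modnXm pa1 modnXm exp1n.
rewrite Dab expnD -modnMml (mulnC kn) expnM -modnXm pb1 modnXm exp1n modnMml mul1n.
by [].
Qed.

Lemma dvdn_expB1_mul (r p a k : nat) : 0 < p ->
  r %| p ^ a - 1 -> r %| p ^ (a * k) - 1.
Proof.
move=> p_gt0; rewrite !dvdn_expB1 // => /eqP pa1.
by apply/eqP; rewrite expnM -modnXm pa1 modnXm exp1n.
Qed.

Lemma coprime_dvdn_expB1 (r p n : nat) : prime r -> 0 < p -> 0 < n ->
  r %| p ^ n - 1 -> coprime r p.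
Proof.
move=> pr_r p_gt0 n_gt0 rn; rewrite prime_coprime //; apply: contraL rn => rp.
rewrite dvdn_expB1 // -modnXm (eqP rp) exp0n // eq_sym mod0n.
by rewrite modn_small ?prime_gt1.
Qed.

(** In the factorisation of p^n - 1 into cyclotomic values, the indices dividing m contribute p^m -
    1, and n is among the remaining indices. *)
Lemma Cyclotomic_mul_dvd (n m p : nat) : 0 < p -> 0 < n -> m %| n -> m < n ->
  `|('Phi_n).[p%:Z]%R| * (p ^ m - 1) %| p ^ n - 1.
Proof.
move=> p_gt0 n_gt0 dv_mn lt_mn; have m_gt0 := dvdn_gt0 n_gt0 dv_mn.
have pE k : p ^ k - 1 = `|(p%:Z ^+ k - 1)%R|.
  by rewrite -[Posz p]natz -natrX natz subzn // expn_gt0 p_gt0.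
rewrite !pE -abszM -!prod_Cyclotomic_eval // [X in _ %| `|X|](bigID (dvdn^~ m)) /=.
have -> : (\prod_(e <- divisors n | (e %| m)%N) ('Phi_e).[p%:Z]
          = \prod_(e <- divisors m) ('Phi_e).[p%:Z])%R.
  rewrite -big_filter; apply/perm_big/uniq_perm; rewrite ?filter_uniq ?divisors_uniq //.
  move=> e; rewrite mem_filter -!dvdn_divisors //.
  by rewrite andb_idr // => /dvdn_trans->.
rewrite [X in _ %| `|(_ * X)%R|](big_rem n) -?dvdn_divisors //= (gtnNdvd m_gt0 lt_mn) /=.
by rewrite mulrCA !abszM mulnA dvdn_mulr.
Qed.

Lemma dvdn_geometric (y s P : nat) : 1 < y ->
  P * (y - 1) %| y ^ s - 1 -> P %| \sum_(i < s) y ^ i.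
Proof.
by move=> y_gt1; rewrite !subn1 predn_exp mulnC dvdn_pmul2l // ltn_predRL.
Qed.

Lemma geometric_mod (r y s : nat) : y = 1 %[mod r] ->
  \sum_(i < s) y ^ i = s %[mod r].
Proof.
move=> y1; elim: s => [|s IH]; first by rewrite big_ord0.
rewrite big_ord_recr /= -modnDml IH modnDml -modnDmr -modnXm y1 modnXm exp1n.
by rewrite modnDmr addn1.
Qed.

(** Writing y = 1 + ur gives y^i = 1 + iur modulo r^2. The sum is then r + ur C(r, 2), and the odd
    prime r divides C(r, 2). *)
Lemma geometric_prime_mod (r y : nat) : prime r -> 2 < r -> 0 < y -> y = 1 %[mod r] ->
  \sum_(i < r) y ^ i = r %[mod r ^ 2].
Proof.
move=> pr_r r_gt2 y_gt0 /eqP; rewrite eqn_mod_dvd // => /dvdnP[u Du].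
have {Du} -> : y = 1 + u * r by rewrite -Du subnKC.
have yi i : (1 + u * r) ^ i = 1 + i * (u * r) %[mod r ^ 2].
  elim: i => [|i IH]; first by rewrite expn0 mul0n.
  rewrite expnS -modnMmr IH modnMmr.
  have -> : (1 + u * r) * (1 + i * (u * r)) = (i * u * u) * r ^ 2 + (1 + i.+1 * (u * r)).
    by rewrite expnS expn1; lia.
  by rewrite modnMDl.
rewrite -modn_summ (eq_bigr (fun i : 'I_r => (1 + i * (u * r)) %% r ^ 2)) => [|i _].
  rewrite modn_summ big_split /= sum1_card card_ord -big_distrl /= -(big_mkord xpredT id).
  have /dvdnP[k Dk] : r %| 'C(r, 2) by apply: prime_dvd_bin.
  rewrite bin2_sum Dk addnC.
  by rewrite (_ : k * r * (u * r) = (k * u) * r ^ 2) ?modnMDl // expnS expn1; lia.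
exact: yi.
Qed.

(** For g < n dividing n with r dividing p^g - 1, and a prime s dividing n/g, the cyclotomic value
    divides (p^n - 1)/(p^(n/s) - 1), a sum of s terms all equal to 1 modulo r. Hence r divides s,
    and n/g is a power of r. *)
Lemma nonprimitive_prime_divisor (n r p i : nat) : 1 < p -> 0 < i < n -> prime r ->
    r %| `|('Phi_n).[Posz p]%R| -> r %| p ^ i - 1 ->
  [/\ r %| n, r %| p ^ (n %/ r) - 1
    & forall s, prime s -> s %| n -> s != r -> s < r].
Proof.
move=> p_gt1 /andP[i_gt0 lt_in] pr_r rP ri; have p_gt0 := ltnW p_gt1.
have n_gt0 : 0 < n by apply: leq_ltn_trans lt_in.
have Pdvd m : m %| n -> m < n -> `|('Phi_n).[Posz p]%R| %| \sum_(k < n %/ m) (p ^ m) ^ k.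
  move=> dv_mn lt_mn; have m_gt0 := dvdn_gt0 n_gt0 dv_mn.
  apply: dvdn_geometric; first by rewrite -(exp1n m) ltn_exp2r.
  by rewrite -expnM (mulnC m) divnK // Cyclotomic_mul_dvd.
have rn : r %| p ^ n - 1.
  have := Cyclotomic_mul_dvd p_gt0 n_gt0 (dvd1n n) (leq_ltn_trans i_gt0 lt_in).
  by apply: dvdn_trans; rewrite dvdn_mulr.
have r'p : coprime p r by rewrite coprime_sym (coprime_dvdn_expB1 pr_r _ n_gt0).
have rr1 : r %| p ^ r.-1 - 1.
  by rewrite dvdn_expB1 // -totient_prime // Euler_exp_totient.
(* The argument i makes g smaller than n; the argument r - 1 puts the prime factors of n other than
   r below r. *)
pose g := gcdn n (gcdn i r.-1).
have rg : r %| p ^ g - 1.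
  by apply: dvdn_expB1_gcd => //; apply: dvdn_expB1_gcd.
have g_gt0 : 0 < g by rewrite gcdn_gt0 n_gt0.
have gn : g %| n := dvdn_gcdl _ _.
have lt_gn : g < n.
  apply: leq_ltn_trans lt_in; apply: dvdn_leq => //.
  by apply: dvdn_trans (dvdn_gcdr _ _) (dvdn_gcdl _ _).
have only_r s : prime s -> s %| n %/ g -> s = r /\ r %| p ^ (n %/ s) - 1.
  move=> pr_s sng; have sn : s %| n by apply: dvdn_trans sng (dvdn_div _).
  have rns : r %| p ^ (n %/ s) - 1.
    have /dvdnP[k Dk] : g %| n %/ s.
      by rewrite dvdn_divRL // mulnC -dvdn_divRL.
    by rewrite Dk mulnC dvdn_expB1_mul.
  split=> //; apply/eqP; rewrite -[_ == _]/(s == r) eq_sym -dvdn_prime2 //.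
  have := dvdn_trans rP (Pdvd (n %/ s) (dvdn_div sn) _).
  rewrite divnA // mulKn // => /(_ _)/eqP.
  rewrite geometric_mod; last by apply/eqP; rewrite -dvdn_expB1.
  by move=> H; apply/eqP/H; rewrite ltn_Pdiv // prime_gt1.
have ng_gt1 : 1 < n %/ g by rewrite ltn_divRL // mul1n.
have [s pr_s sng] := pdivP ng_gt1; have [Ds rnr] := only_r s pr_s sng.
rewrite Ds in sng rnr; split=> //; first by apply: dvdn_trans sng (dvdn_div _).
move=> t pr_t tn ne_tr; have tg : t %| g.
  move: tn; rewrite -(divnK gn) Euclid_dvdM // => /orP[/(only_r t pr_t)[Dt _]|//].
  by rewrite Dt eqxx in ne_tr.
have tr1: t %| r.-1 by apply: dvdn_trans tg _; apply: dvdn_trans (dvdn_gcdr _ _) (dvdn_gcdr _ _).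
by rewrite -(prednK (prime_gt0 pr_r)) ltnS dvdn_leq // -ltnS prednK ?prime_gt1 ?prime_gt0.
Qed.

(* Zsigmondy's theorem; the prime factors l = 2, 3 of n are excluded because the bound
   (p ^ l - 1) / (p + 1) > l on the cyclotomic value fails for them at p = 2. *)
Theorem primitive_prime_divisor (n p : nat) : 1 < n -> 1 < p ->
    (forall l, prime l -> l %| n -> 4 < l) ->
  exists2 r, prime r & r %| p ^ n - 1 /\ (forall i, 0 < i < n -> ~~ (r %| p ^ i - 1)).
Proof.
move=> n_gt1 p_gt1 l_gt4; have p_gt0 := ltnW p_gt1; have n_gt0 := ltnW n_gt1.
pose P := `|('Phi_n).[Posz p]%R|.
have P_gt l : prime l -> l %| n -> l < P.
  move=> pr_l /dvdnP[m Dn]; rewrite Dn muln_gt0 in n_gt0.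
  case/andP: n_gt0 => m_gt0 _.
  have := Cyclotomic_gt_prime pr_l (l_gt4 l pr_l _) m_gt0 p_gt1.
  by rewrite Dn dvdn_mull // mulnC => /(_ isT); rewrite /P Dn; lia.
have Pn : P %| p ^ n - 1.
  have := Cyclotomic_mul_dvd p_gt0 n_gt0 (dvd1n n) n_gt1.
  by apply: dvdn_trans; rewrite dvdn_mulr.
have [r0 pr_r0 r0n] := pdivP n_gt1.
have P_gt1 : 1 < P by apply: leq_ltn_trans (prime_gt0 pr_r0) (P_gt _ pr_r0 r0n).
pose nonprim r := [exists i : 'I_n, (0 < i) && (r %| p ^ i - 1)].
have [/allP all_np | /allPn[r]] := boolP (all nonprim (primes P)); last first.
  rewrite mem_primes => /and3P[pr_r _ rP] np_r; exists r => //; split.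
    exact: dvdn_trans rP Pn.
  move=> i /andP[i_gt0 lt_in]; apply: contra np_r => ri.
  by apply/existsP; exists (Ordinal lt_in); rewrite i_gt0.
(* If no prime factor of [P] is primitive, each of them is the largest prime factor of n, so [P] is
   a power of a single prime r. As r^2 does not divide [P], this contradicts [P] > r. *)
have np r : prime r -> r %| P -> [/\ r %| n, r %| p ^ (n %/ r) - 1
    & forall s, prime s -> s %| n -> s != r -> s < r].
  move=> pr_r rP; have /existsP[i /andP[i_gt0 ri]] : nonprim r.
    by apply: all_np; rewrite mem_primes pr_r rP ltnW.
  by apply: nonprimitive_prime_divisor rP ri; rewrite ?i_gt0 ?ltn_ord.
have [r pr_r rP] := pdivP P_gt1; have [rn rnr r_max] := np r pr_r rP.
have P_r : r.-nat P.
  apply/pnatP => [|s pr_s sP]; first exact: ltnW.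
  apply/eqP/eqP; apply/negPn/negP => ne_sr.
  have [sn _ s_max] := np s pr_s sP.
  have := ltn_trans (r_max s pr_s sn ne_sr) (s_max r pr_r rn _).
  by rewrite ltnn eq_sym ne_sr => /(_ isT).
have [k Dk] := p_natP P_r.
(* [P] divides (p^n - 1)/(p^(n/r) - 1), a sum of r powers that is r modulo r^2. *)
have r2P : ~~ (r ^ 2 %| P).
  have lt_nr : n %/ r < n by rewrite ltn_Pdiv // prime_gt1.
  have nr_gt0 : 0 < n %/ r by rewrite (divn_gt0 _ (prime_gt0 pr_r)) dvdn_leq.
  have dv : P %| \sum_(i < r) (p ^ (n %/ r)) ^ i.
    apply: dvdn_geometric; first by rewrite -(exp1n (n %/ r)) ltn_exp2r.
    by rewrite -expnM divnK // Cyclotomic_mul_dvd // dvdn_div.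
  apply/negP=> /dvdn_trans/(_ dv).
  rewrite /dvdn geometric_prime_mod ?expn_gt0 ?p_gt0 //; last 2 first.
  - by apply: leq_trans (l_gt4 _ pr_r rn).
  - by apply/eqP; rewrite -dvdn_expB1.
  by move/(dvdn_leq (prime_gt0 pr_r)); rewrite leqNgt -{1}[r]expn1 ltn_exp2l ?prime_gt1.
have := P_gt r pr_r rn; rewrite ltnNge => /negP[].
move: r2P; rewrite Dk; apply: contraR; rewrite -ltnNge => lt_r.
apply: dvdn_exp2l; rewrite ltnNge; apply: contraL lt_r => k1.
by rewrite -leqNgt -[X in _ <= X]expn1 leq_pexp2l ?(prime_gt0 pr_r).
Qed.

End Zsigmondy.

(** * Normalisers of r-subgroups of GL_d(p), for r a primitive prime divisor *)

Section Eigenvalues.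
Import GRing.Theory.
Local Open Scope ring_scope.

(** If v is a row eigenvector of X for a, then v B^-1 is one for a^j. *)
Lemma eigenvalue_conj_power (F : fieldType) (n j : nat) (X B : 'M[F]_n.+1) (a : F) :
  B \in unitmx -> X *m B = B *m X ^+ j -> eigenvalue X a -> eigenvalue X (a ^+ j).
Proof.
move=> uB XB /eigenvalueP[v vX v0]; apply/eigenvalueP; exists (v *m invmx B).
  have -> : v *m invmx B *m X = v *m X ^+ j *m invmx B.
    rewrite -!mulmxA; congr (_ *m _); apply: (canRL (mulmxK uB)).
    by rewrite -mulmxA XB mulKmx.
  suffices -> : v *m X ^+ j = a ^+ j *: v by rewrite scalemxAl.
  elim: j {XB} => [|j IH]; first by rewrite expr0 mulmx1 scale1r.
  by rewrite exprS mulmxA vX -scalemxAl IH scalerA exprS.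
by apply: contraNneq v0 => vB; rewrite -[v](mulmxKV uB) vB mul0mx.
Qed.

(* Over an algebraic closure, the eigenvalues of X are the Frobenius conjugates
   a ^ (p ^ i) of any one of them. *)
Lemma conj_power_Fp (p r n j : nat) (X B : 'M['F_p]_n.+1) :
    prime p -> prime r -> (r %| p ^ n.+1 - 1)%N ->
    (forall i, (0 < i < n.+1)%N -> ~~ (r %| p ^ i - 1)%N) ->
    X ^+ r = 1 -> ~~ eigenvalue X 1 ->
    B \in unitmx -> X *m B = B *m X ^+ j ->
  exists2 i, (i < n.+1)%N & (j = p ^ i %[mod r])%N.
Proof.
move=> pr_p pr_r r_pn prim Xr X1 uB XB; have p_gt0 := prime_gt0 pr_p.
have [L [f _]] := countable_algebraic_closure 'F_p.
pose XL := map_mx f X; pose q := map_poly f (char_poly X).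
have pchL : p \in [pchar L] by rewrite (fmorph_pchar f) pchar_Fp.
have eigE a : eigenvalue XL a = root q a.
  by rewrite eigenvalue_root_char /q map_char_poly.
have szq : size q = n.+2 by rewrite size_map_poly size_char_poly.
have [a qa] : exists a, root q a by apply/closed_rootP; rewrite szq.
(* The coefficients of [q] come from the prime field, so the Frobenius map fixes them. *)
have Frob b : root q b -> root q (b ^+ p).
  move/eqP=> qb; apply/eqP; rewrite /q.
  have <- : map_poly (pFrobenius_aut pchL) (map_poly f (char_poly X))
          = map_poly f (char_poly X).
    rewrite -map_poly_comp; apply: eq_map_poly => c /=.
    by rewrite pFrobenius_autE -rmorphXn /= -[in RHS](expf_card c) card_Fp.
  by rewrite -(pFrobenius_autE pchL) horner_map /= -/q qb pFrobenius_aut0.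
have ai i : root q (a ^+ (p ^ i)).
  elim: i => [|i IH]; first by rewrite expn0 expr1.
  by rewrite expnSr exprM Frob.
have a_r : a ^+ r = 1.
  have : eigenvalue XL a by rewrite eigE.
  case/eigenvalueP=> v vX v0.
  have : v *m XL ^+ r = a ^+ r *: v.
    elim: (r) => [|k IH]; first by rewrite expr0 mulmx1 scale1r.
    by rewrite exprS mulmxA vX -scalemxAl IH scalerA exprS.
  rewrite -rmorphXn /= Xr rmorph1 mulmx1 => /eqP.
  rewrite -[X in X == _]scale1r -subr_eq0 -scalerBl scaler_eq0 (negPf v0) orbF.
  by rewrite subr_eq0 eq_sym => /eqP.
have a1 : a != 1.
  apply: contraNneq X1 => Da; rewrite eigenvalue_root_char -(fmorph_root f).
  by rewrite rmorph1 -Da.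
have prim_a : r.-primitive_root a.
  have [m prim_m m_r] := prim_order_exists (prime_gt0 pr_r) a_r.
  have m1 : m != 1%N.
    by apply: contraNneq a1 => Dm; rewrite -(prim_expr_order prim_m) Dm expr1.
  by rewrite -(prime_nt_dvdP pr_r m1 m_r).
have co_rp : coprime r p := coprime_dvdn_expB1 pr_r p_gt0 (ltn0Sn n) r_pn.
pose s := [seq a ^+ (p ^ i) | i <- iota 0 n.+1].
(* Two equal conjugates would make r divide p^(k - i) - 1 with 0 < k - i < n + 1. *)
have uniq_s : uniq s.
  rewrite map_inj_in_uniq ?iota_uniq // => i k; rewrite !mem_iota !add0n /=.
  wlog le_ik : i k / (i <= k)%N => [IH lt_i lt_k E|_ lt_k].
    by case/orP: (leq_total i k) => /IH; [apply | move/(_ lt_k lt_i (esym E))].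
  move/eqP; rewrite (eq_prim_root_expr prim_a) eq_sym => E.
  apply/eqP; rewrite eqn_leq le_ik /= leqNgt; apply/negP => lt_ik.
  have := prim (k - i)%N; rewrite subn_gt0 lt_ik (leq_ltn_trans (leq_subr _ _)) //.
  move/(_ isT)/negP; apply; move: E; rewrite eqn_mod_dvd ?leq_pexp2l //.
  rewrite -(subnKC le_ik) expnD -{2}[(p ^ i)%N]muln1 -mulnBr subnKC //.
  by rewrite Gauss_dvdr // coprimeXr.
(* Otherwise the characteristic polynomial, of degree n + 1, would have n + 2 distinct roots. *)
have aj : a ^+ j \in s.
  apply/negPn/negP => s'aj.
  have sz_s : size (a ^+ j :: s) = n.+2 by rewrite /= size_map size_iota.
  have := @max_poly_roots _ q (a ^+ j :: s).
  rewrite -size_poly_eq0 cons_uniq s'aj uniq_s sz_s szq ltnn.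
  suffices -> : all (root q) (a ^+ j :: s) by move/(_ isT isT isT).
  rewrite -cat1s all_cat all_seq1.
  apply/andP; split; last by apply/allP=> _ /mapP[i _ ->].
  rewrite -eigE; apply: (@eigenvalue_conj_power _ _ _ _ (map_mx f B)).
  - by rewrite map_unitmx.
  - by rewrite -rmorphXn /= -!map_mxM XB.
  - by rewrite eigE.
have /mapP[i] := aj; rewrite mem_iota add0n => /= lt_i /eqP.
by rewrite (eq_prim_root_expr prim_a) => /eqP; exists i.
Qed.

End Eigenvalues.

Import GRing.Theory GroupScope.

Section PrimitivePrimeAction.

Variables (gT : finGroupType) (p r d : nat) (E A : {group gT}).
Hypotheses (abelE : p.-abelem E) (cardE : #|E| = (p ^ d)%N) (d_gt0 : 0 < d).
Hypotheses (pr_p : prime p) (pr_r : prime r) (r_pd : r %| p ^ d - 1).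
Hypothesis r_prim : forall i, 0 < i < d -> ~~ (r %| p ^ i - 1).
Hypotheses (nEA : A \subset 'N(E)) (cEA : 'C_A(E) = 1).

Lemma card_cent_pgroup_mod (l : nat) (B L : {group gT}) :
  l.-group L -> L \subset 'N(B) -> #|B| = #|'C_B(L)| %[mod l].
Proof.
move=> lL nBL; rewrite (pgroup_fix_mod (to := 'J%act) lL) ?afixJ //.
by rewrite astabsJ.
Qed.

(** Fixed points are counted modulo r. The order of the centraliser of Q in E is a power of p
    congruent to p^d, hence 1 or p^d, and faithfulness excludes p^d. So an invariant subgroup of
    order p^i has p^i = 1 modulo r, which forces i = 0 or i = d. *)
Lemma primitive_rgroup_irr (Q B : {group gT}) : Q \subset A -> r.-group Q ->
  Q :!=: 1 -> B \subset E -> Q \subset 'N(B) -> B :=: 1 \/ B :=: E.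
Proof.
move=> sQA rQ ntQ.
have co_rp := coprime_dvdn_expB1 pr_r (prime_gt0 pr_p) d_gt0 r_pd.
have card_p (C : {group gT}) : C \subset E -> exists2 i, #|C| = (p ^ i)%N & i <= d.
  move=> sCE; have := cardSg sCE; rewrite cardE => /(dvdn_pfactor _ _ pr_p)[i] ? ?.
  by exists i.
have CE1 : 'C_E(Q) = 1.
  have [i Ci le_id] := card_p _ (subsetIl E 'C(Q)).
  have /eqP := card_cent_pgroup_mod rQ (subset_trans sQA nEA).
  rewrite cardE Ci eqn_mod_dvd; last by rewrite leq_exp2l ?prime_gt1.
  rewrite -{1}(subnKC le_id) expnD -{2}[(p ^ i)%N]muln1 -mulnBr.
  rewrite Gauss_dvdr ?coprimeXr // => r_di.
  have [i0|i_gt0] := posnP i; first by apply/eqP; rewrite trivg_card1 Ci i0.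
  have Did : i = d.
    apply/eqP; rewrite eqn_leq le_id leqNgt; apply: contraL r_di => lt_id.
    by apply: r_prim; rewrite subn_gt0 lt_id -{2}[d]subn0 ltn_sub2l.
  have cQE : Q \subset 'C(E).
    rewrite centsC; apply/setIidPl/eqP.
    by rewrite eqEcard subsetIl cardE Ci Did leqnn.
  by case/eqP: ntQ; apply/trivgP; rewrite -cEA subsetI sQA.
move=> sBE nBQ; have [i Bi le_id] := card_p _ sBE.
have /eqP := card_cent_pgroup_mod rQ nBQ.
have -> : 'C_B(Q) = 1 by apply/trivgP; rewrite -CE1 setSI.
rewrite cards1 Bi -dvdn_expB1 ?prime_gt0 // => r_i.
have [i0|i_gt0] := posnP i; [left | right].
  by apply/eqP; rewrite trivg_card1 Bi i0.
apply/eqP; rewrite eqEcard sBE cardE Bi leq_exp2l ?prime_gt1 // leqNgt.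
by apply: contraL r_i => lt_id; apply: r_prim; rewrite i_gt0.
Qed.

(** An element b of order l normalising Q normalises the subgroup of order r of the cyclic centre of
    Q, and raises its generator x to a power j with j^l = 1 modulo r. Comparing eigenvalues gives j
    = p^i modulo r; since l does not divide d, this leaves j = 1, so b commutes with x, which is
    impossible. *)
Lemma primitive_rgroup_norm (l : nat) (Q : {group gT}) : prime l ->
    ~~ (l %| d) -> ~~ (l %| p ^ d - 1) -> Q \subset A -> r.-group Q -> Q :!=: 1 ->
  ~~ (l %| #|'N_A(Q)|).
Proof.
move=> pr_l l'd l'q sQA rQ ntQ; apply/negP=> /(Cauchy pr_l)[b].
case/setIP=> Ab nQb ob.
have ntE : E :!=: 1.
  by rewrite trivg_card1 cardE -(expn0 p) eqn_exp2l ?prime_gt1 -?lt0n.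
have sZQ : 'Z(Q) \subset Q := center_sub Q.
have sZA := subset_trans sZQ sQA; have nEZ := subset_trans sZA nEA.
have rZ : r.-group 'Z(Q) := pgroupS sZQ rQ.
have ntZ : 'Z(Q) != 1 by rewrite center_nil_eq1 ?(pgroup_nil rQ).
(* An abelian group with a faithful irreducible representation is cyclic. *)
have cycZ : cyclic 'Z(Q).
  apply: (@mx_faithful_irr_abelian_cyclic _ _ _ _ (abelem_repr abelE ntE nEZ)).
  - apply: abelem_mx_faithful; apply/trivgP; rewrite -cEA setSI //.
  - apply/abelem_mx_irrP/mingroupP; split=> [|B]; first by rewrite ntE.
    case/andP=> ntB nBZ sBE; case: (primitive_rgroup_irr sZA rZ ntZ sBE nBZ) => //.
    by move/eqP; rewrite (negPf ntB).
  - exact: center_abelian.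
have [x Zx ox] : {x | x \in 'Z(Q) & #[x] = r}.
  by apply: Cauchy => //; have [_] := pgroup_pdiv rZ ntZ.
have Ax : x \in A := subsetP sZA x Zx.
have [j Dj] : exists j, x ^ b = x ^+ j.
  apply/cycleP; have: <[x]> \char Q.
    apply: char_trans (center_char Q).
    by rewrite sub_cyclic_char ?cycle_subG.
  by move/char_norm_trans/(_ (subxx _))/subsetP/(_ b nQb)/normP <-; rewrite memJ_conjg cycle_id.
have rX : r.-group <[x]> by rewrite /pgroup -orderE ox pnat_id.
have sXA : <[x]> \subset A by rewrite cycle_subG.
have ntX : <[x]> != 1 by rewrite cycle_eq1 -order_gt1 ox prime_gt1.
have p_gt0 := prime_gt0 pr_p.
have CE_neq (a : gT) : a \in A -> a != 1 -> 'C_E(<[a]>) <> E.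
  move=> Aa nt_a CE; case/eqP: nt_a; apply/set1gP; rewrite -cEA inE Aa /=.
  by have /setIidPl := CE; rewrite centsC cycle_subG.
(* If b commutes with x, then x normalises the centraliser of b in E, which is trivial or E by
   irreducibility. The first makes l divide p^d - 1, the second contradicts faithfulness. *)
have b_fix : x ^+ j = x -> False.
  move=> xj; have cbx : b \in 'C[x].
    by rewrite cent1C; apply/cent1P/commgP/conjg_fixP; rewrite Dj xj.
  have lb : l.-group <[b]> by rewrite /pgroup -orderE ob pnat_id.
  have nEb : <[b]> \subset 'N(E) by rewrite cycle_subG (subsetP nEA).
  have nCX : <[x]> \subset 'N('C_E(<[b]>)).
    rewrite cycle_subG cent_cycle; apply/normP.
    rewrite conjIg (normsP nEA x Ax) -cent1J; congr (_ :&: 'C[_]).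
    by apply/conjg_fixP/commgP; apply: commute_sym; apply/cent1P; rewrite cent1C.
  have := card_cent_pgroup_mod lb nEb.
  have [-> | CE] := primitive_rgroup_irr sXA rX ntX (subsetIl _ _) nCX.
    move/eqP; rewrite cards1 cardE -dvdn_expB1 //; exact/negP.
  by case: (CE_neq b) => //; rewrite -order_gt1 ob prime_gt1.
pose rG := abelem_repr abelE ntE nEA.
have dimE : (abelem_dim' E).+1 = d by rewrite (dim_abelemE abelE ntE) cardE pfactorK.
have [||||||i lt_i Di] := @conj_power_Fp p r _ j (rG x) (rG b) pr_p pr_r; rewrite ?dimE //.
- by rewrite -repr_mxX // -ox expg_order repr_mx1.
- apply/eigenvalueP=> -[v vx v0].
  have nCX : <[x]> \subset 'N('C_E(<[x]>)).
    by apply: cents_norm; rewrite centsC subsetIr.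
  have [C1 | ] := primitive_rgroup_irr sXA rX ntX (subsetIl _ _) nCX; last first.
    by apply: CE_neq; rewrite // -order_gt1 ox prime_gt1.
  have : rVabelem abelE ntE v \in 'C_E(<[x]>).
    rewrite inE mem_rVabelem cent_cycle; apply/cent1P/commgP/conjg_fixP.
    by rewrite -(rVabelemJ abelE ntE nEA) // vx scale1r.
  rewrite C1 => /set1gP Dv; case/eqP: v0.
  by apply: (rVabelem_inj abelE ntE); rewrite Dv rVabelem0.
- exact: repr_mx_unit.
- by rewrite -repr_mxX // -!repr_mxM ?groupX // -Dj conjgC.
apply: b_fix; rewrite -[RHS]expg1; apply/eqP; rewrite eq_expg_mod_order ox.
have jl : j ^ l = 1 %[mod r].
  have xbk k : x ^ (b ^+ k) = x ^+ (j ^ k).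
    elim: k => [|k IH]; first by rewrite conjg1.
    by rewrite expgSr conjgM IH conjXg Dj -expgM expnS.
  apply/eqP; rewrite -[X in _ == _ %[mod X]]ox -eq_expg_mod_order -xbk -ob.
  by rewrite expg_order conjg1.
have r_il : r %| p ^ (i * l) - 1.
  by rewrite dvdn_expB1 // expnM -modnXm -Di modnXm jl.
have [i0 | i_gt0] := posnP i; first by rewrite Di i0.
(* The prime r would divide p^k - 1 for k = gcd(d, il) = gcd(d, i), where 0 < k < d. *)
have := dvdn_expB1_gcd p_gt0 d_gt0 r_pd r_il.
rewrite Gauss_gcdl; last by rewrite coprime_sym prime_coprime.
apply: contraLR => _; apply: r_prim; rewrite gcdn_gt0 d_gt0 /=.
have lt_id : i < d by move: lt_i; rewrite dimE.
by apply: leq_ltn_trans lt_id; apply: dvdn_leq i_gt0 (dvdn_gcdr _ _).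
Qed.
End PrimitivePrimeAction.

Lemma AutM (gT : finGroupType) (a : {perm gT}) : a \in Aut [set: gT] ->
  {morph a : x y / x * y}.
Proof. by move/Aut_morphic/morphicP=> aM x y; rewrite aM ?inE. Qed.

Lemma Aut1 (gT : finGroupType) (a : {perm gT}) : a \in Aut [set: gT] -> a 1 = 1.
Proof. by move/AutM=> aM; apply: (mulgI (a 1)); rewrite -aM !mulg1. Qed.

Lemma AutV (gT : finGroupType) (a : {perm gT}) x : a \in Aut [set: gT] ->
  a x^-1 = (a x)^-1.
Proof.
move=> Aa; apply: (mulgI (a x)).
by rewrite -(AutM Aa) !mulgV (Aut1 Aa).
Qed.

Section Holomorph.
Variable gT : finGroupType.
Local Notation tr := (@actperm gT [set: gT] gT 'R).

Lemma trE (x y : gT) : tr x y = y * x. Proof. by rewrite actpermE. Qed.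

Lemma tr_conj_Aut (a : {perm gT}) x : a \in Aut [set: gT] ->
  tr x ^ a = tr (a x).
Proof.
move=> Aa; apply/permP=> y; rewrite /conjg !permM !trE.
by rewrite (AutM Aa) permKV.
Qed.

(* Aut H normalises, and acts faithfully on, the group of right translations. *)
Lemma Aut_rgroup_norm (p r d l : nat) (Q : {group {perm gT}}) :
    p.-abelem [set: gT] -> #|gT| = (p ^ d)%N -> 0 < d -> prime p -> prime r ->
    r %| p ^ d - 1 -> (forall i, 0 < i < d -> ~~ (r %| p ^ i - 1)) -> prime l ->
    ~~ (l %| d) -> ~~ (l %| p ^ d - 1) ->
    Q \subset Aut [set: gT] -> r.-group Q -> Q :!=: 1 ->
  ~~ (l %| #|'N_(Aut [set: gT])(Q)|).
Proof.
move=> abG cG d_gt0 pr_p pr_r r_pd r_prim pr_l l'd l'q.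
have inj_tr : 'injm tr.
  apply/injmP=> x y _ _ /permP/(_ 1); by rewrite !trE !mul1g.
apply: (@primitive_rgroup_norm _ p r d (tr @* [set: gT])%G (Aut_group [set: gT])) => //.
- by rewrite injm_abelem ?subsetT.
- by rewrite card_injm ?subsetT ?cardsT.
- apply/subsetP=> a Aa; rewrite inE; apply/subsetP=> u.
  case/imsetP=> _ /morphimP[x _ _ ->] ->; rewrite tr_conj_Aut //.
  by rewrite mem_morphim ?inE.
- apply/trivgP/subsetP=> a /setIP[Aa cEa]; apply/set1gP/permP=> x.
  have /(centP cEa)/commute_sym/commgP/conjg_fixP : tr x \in tr @* [set: gT].
    by rewrite mem_morphim ?inE.
  by rewrite tr_conj_Aut // => /permP/(_ 1); rewrite !trE !mul1g perm1.
Qed.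
End Holomorph.

Lemma expn_odd_mod3 (p d : nat) : p = 2 %[mod 3] -> odd d -> p ^ d = 2 %[mod 3].
Proof.
move=> p2 odd_d; rewrite -modnXm p2 modnXm -(odd_double_half d) odd_d add1n.
by rewrite -mul2n expnS expnM -modnMmr -modnXm exp1n.
Qed.

(** * A 3-cycle of the coordinates paired with the trivial automorphism *)

Section TrivialAutomorphism.

Variables (gT : finGroupType) (p d : nat) (S : {group {perm gT} * 'S_3}).
Hypotheses (abG : p.-abelem [set: gT]) (cG : #|gT| = (p ^ d)%N) (d_gt0 : 0 < d).
Hypotheses (pr_p : prime p) (p2 : p = 2 %[mod 3]) (odd_d : odd d).
Hypothesis (d3 : ~~ (3 %| d)).
Hypothesis S_Aut : forall w, w \in S -> w.1 \in Aut [set: gT].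
Hypothesis S_trans : forall a b : gT, a != 1 -> b != 1 ->
  exists2 w, w \in S & w.1 a = b \/ w.1 a = b^-1.
Hypothesis S_3 : exists2 w, w \in S & #[w.2] = 3.

Let A := (fst @* S)%G.

Let l'q : ~~ (3 %| p ^ d - 1).
Proof. by rewrite dvdn_expB1 ?prime_gt0 // expn_odd_mod3. Qed.

Let sAA : A \subset Aut [set: gT].
Proof. by apply/subsetP=> _ /morphimP[w _ Sw ->]; apply: S_Aut. Qed.

Let orbit_or_inv (a b : gT) : a != 1 -> b != 1 ->
  (b \in orbit 'P A a) || (b^-1 \in orbit 'P A a).
Proof.
move=> a1 b1; have [w Sw wab] := S_trans a1 b1.
have Aw : w.1 \in A by rewrite mem_morphim ?inE.
by case: wab => <-; rewrite (mem_orbit 'P a Aw) ?orbT.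
Qed.

(** The nonidentity elements form one orbit O of A, or the disjoint union of O and its set of
    inverses. So O has p^d - 1 or half as many elements, and the odd prime r divides its size. *)
Lemma dvdn_half_orbit (r : nat) : prime r -> odd r -> r %| p ^ d - 1 -> r %| #|A|.
Proof.
move=> pr_r odd_r r_q.
have [a a1] : exists a : gT, a != 1.
  apply/existsP; rewrite -negb_forall; apply: contraL (prime_gt1 pr_p) => /forallP gT1.
  have : #|gT| = 1%N.
    by rewrite (@eq_card1 _ (1 : gT)) // => x; rewrite !inE -[_ == _]negbK gT1.
  rewrite cG -leqNgt => pd1; rewrite -pd1.
  by rewrite -{1}[p]expn1 leq_exp2l ?prime_gt1.
set O := orbit 'P A a; apply: dvdn_trans (dvdn_orbit 'P A a).
have AutA c : c \in A -> c \in Aut [set: gT] by apply: (subsetP sAA).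
have O1 x : x \in O -> x != 1.
  case/imsetP=> c Ac ->; rewrite /= apermE; apply: contraNneq a1 => ca1.
  by apply/eqP/(@perm_inj _ c); rewrite (Aut1 (AutA c Ac)).
have cardC : #|[set~ (1 : gT)]| = (p ^ d - 1)%N by rewrite cardsC1 cG subn1.
have [Oa|O'a] := boolP (a^-1 \in O).
  have sVO x : x \in O -> x^-1 \in O.
    case/imsetP=> c Ac ->; rewrite /= apermE -(AutV _ (AutA c Ac)).
    by apply: orbit_trans Oa; apply: (mem_orbit 'P).
  suffices -> : #|O| = #|[set~ (1 : gT)]| by rewrite cardC.
  apply: eq_card => x; rewrite !inE.
  apply/idP/idP=> [/O1//|x1]; have /orP[//|/sVO] := orbit_or_inv a1 x1.
  by rewrite invgK.
have O'V x : x \in O -> x^-1 \notin O.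
  case/imsetP=> c Ac ->; rewrite /= apermE -(AutV _ (AutA c Ac)).
  apply: contra O'a => Oc; apply: orbit_trans Oc.
  by rewrite orbit_sym (mem_orbit 'P).
have cardVO : #|[set x^-1 | x in O]| = #|O| by rewrite card_imset //; apply: invg_inj.
have DC : [set~ (1 : gT)] = O :|: [set x^-1 | x in O].
  apply/setP=> x; rewrite !inE; apply/idP/orP=> [x1|[/O1 //|/imsetP[y /O1 y1 ->]]].
    have /orP[|Ox] := orbit_or_inv a1 x1; first by left.
    by right; apply/imsetP; exists x^-1; rewrite ?invgK.
  by rewrite eq_invg1.
have : #|[set~ (1 : gT)]| = (2 * #|O|)%N.
  rewrite DC cardsU cardVO (_ : _ :&: _ = set0) ?cards0 ?subn0 ?mul2n ?addnn //.
  apply/setP=> x; rewrite !inE; apply/negP=> /andP[Ox /imsetP[y Oy Dx]].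
  by have := O'V y Oy; rewrite -Dx Ox.
rewrite cardC => Dpd; have := r_q; rewrite Dpd Gauss_dvdr //.
by rewrite coprime_sym coprime2n.
Qed.

Lemma exists_trivial_aut : exists2 w, w \in S & w.1 = 1 /\ #[w.2] = 3.
Proof.
have [w Sw ow] := S_3.
(* The 3-part of such a v works: its first component is a 3-element of a group of order prime to 3,
   hence trivial. *)
suffices [v Sv [ov l'v]] : exists2 v, v \in S & #[v.2] = 3 /\
    exists2 N : {group {perm gT}}, v.1 \in N & ~~ (3 %| #|N|).
  have [N Nv l'N] := l'v; exists v.`_3; first exact: groupX.
  have fstX : (v.`_3).1 = v.1.`_3 by apply: (morph_constt [morphism of fst]); rewrite inE.
  have sndX : (v.`_3).2 = v.2.`_3 by apply: (morph_constt [morphism of snd]); rewrite inE.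
  rewrite fstX sndX; split; last first.
    by rewrite constt_p_elt // /p_elt ov.
  apply/constt1P; rewrite /p_elt p'natE //; apply: contra l'N => /dvdn_trans; apply.
  exact: order_dvdG.
(* For d = 1 there may be no primitive prime, but Aut H itself has order p - 1, prime to 3. *)
have [d1|d_neq1] := eqVneq d 1%N.
  exists w => //; split=> //; exists (Aut_group [set: gT]).
    exact: S_Aut.
  have cycG : cyclic [set: gT] by apply: prime_cyclic; rewrite cardsT cG d1 expn1.
  rewrite /= card_Aut_cyclic // cardsT cG d1 expn1 totient_prime //.
  by move: l'q; rewrite d1 expn1 subn1.
have d_gt1 : 1 < d by rewrite ltn_neqAle eq_sym d_neq1.
have [|r pr_r [r_pd r_prim]] := @primitive_prime_divisor d p d_gt1 (prime_gt1 pr_p).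
  move=> l pr_l ld; rewrite ltnNge; apply/negP=> le_l.
  have : l \in [:: 2; 3]%N by case: l pr_l le_l {ld} => [|[|[|[|[|]]]]].
  rewrite !inE => /orP[] /eqP Dl; last by case/negP: d3; rewrite -Dl.
  by move: ld; rewrite Dl dvdn2 odd_d.
have p_gt0 := prime_gt0 pr_p.
have co_rp := coprime_dvdn_expB1 pr_r p_gt0 d_gt0 r_pd.
have odd_r : odd r.
  apply/negPn/negP => /(prime_oddPn pr_r) r2.
  have := r_prim 1%N d_gt1; rewrite expn1 r2 dvdn2 negbK oddB // addbT => odd_p.
  by move: co_rp; rewrite r2 coprime2n (negPf odd_p).
have r_neq3 : r != 3 by apply: contraNneq l'q => <-.
pose sndm := [morphism of @snd {perm gT} 'S_3]; pose fstm := [morphism of @fst {perm gT} 'S_3].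
pose K := [group of 'ker_S sndm].
(* The prime r divides the order of S but not that of Sym(3), as it is neither 2 nor 3. *)
have rK : r %| #|K|.
  have rS : r %| #|S|.
    exact: dvdn_trans (dvdn_half_orbit pr_r odd_r r_pd) (dvdn_morphim fstm S).
  have := index_morphim_ker sndm (sub1G S) (subsetT S).
  rewrite morphim1 !indexg1 => cardS; move: rS; rewrite -cardS Euclid_dvdM //.
  case/orP=> [r_snd|rker]; last exact: rker.
  have r6 : r %| 2 * 3.
    rewrite (_ : (2 * 3)%N = #|[set: {perm (ordinal 3)}]|); last by rewrite cardsT card_Sn.
    exact: dvdn_trans r_snd (cardSg (subsetT _)).
  move: r6; rewrite Euclid_dvdM //; case/orP.
    by rewrite (dvdn_prime2 pr_r) // => /eqP r2; move: odd_r; rewrite r2.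
  by rewrite (dvdn_prime2 pr_r) // (negPf r_neq3).
have nKS : K <| S by apply: normalGI; [exact: subsetT | exact: ker_normal].
have [Q sylQ] := Sylow_exists r K.
have [sQK rQ _] := and3P sylQ.
have sQS : Q \subset S := subset_trans sQK (subsetIl _ _).
have ntQ : Q :!=: 1.
  apply: contraL rK => /eqP Q1; have /esym/eqP := card_Hall sylQ.
  by rewrite Q1 cards1 p_part_eq1 mem_primes pr_r cardG_gt0.
have K2 u : u \in K -> u.2 = 1 by case/setIP=> _ /mker.
have ntQ1 : fstm @* Q != 1.
  apply: contraNneq ntQ => Q1; rewrite -subG1; apply/subsetP=> u Qu; apply/set1gP.
  have u1 : u.1 = 1.
    by apply/set1gP; rewrite -Q1 (mem_morphim fstm) ?inE.
  by rewrite [u]surjective_pairing u1 (K2 u (subsetP sQK u Qu)).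
(* The Frattini argument replaces w by a v with the same coordinate permutation that normalises
   Q. *)
have := Sw; rewrite -{1}(Frattini_arg nKS sylQ) => /mulsgP[k v Kk /setIP[Sv nQv] Dw].
exists v => //; split; first by move: ow; rewrite Dw /= (K2 k Kk) mul1g.
exists ('N_(Aut [set: gT])(fstm @* Q))%G.
  rewrite inE S_Aut //=; apply: (subsetP (morphim_norm fstm Q)).
  by apply: (mem_morphim fstm) => //; rewrite inE.
apply: (Aut_rgroup_norm abG cG d_gt0 pr_p pr_r r_pd r_prim) => //.
- by apply: subset_trans sAA; apply: morphimS.
- exact: morphim_pgroup.
Qed.
End TrivialAutomorphism.

(** * Coordinates on the latin square *)

Lemma I3_ind (P : 'I_3 -> Prop) : P 0%R -> P 1%R -> P 2%R -> forall i, P i.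
Proof.
move=> P0 P1 P2 [[|[|[|//]]] lt_i3].
- by rewrite (_ : Ordinal lt_i3 = 0%R) //; apply: val_inj.
- by rewrite (_ : Ordinal lt_i3 = 1%R) //; apply: val_inj.
by rewrite (_ : Ordinal lt_i3 = 2%R) //; apply: val_inj.
Qed.

Section Coordinates.
Variable gT : finGroupType.
Local Notation V := (cell gT).

(* Inverting the third entry makes the Cayley table {(a, b, c) | a b c = 1},
   which is invariant under cyclic shifts. *)
Definition twist (i : 'I_3) (h : gT) := if i == 2%R then h^-1 else h.
Definition coord (x : V) (i : 'I_3) : gT := twist i (tnth (val x) i).

Lemma twistK i : involutive (twist i).
Proof. by move=> h; rewrite /twist; case: (i == _); rewrite ?invgK. Qed.

Lemma twist_inj i : injective (twist i). Proof. exact: can_inj (twistK i). Qed.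

Lemma cell_point_proof (a b : gT) : [tuple a; b; a * b] \in cayley_table gT.
Proof. by apply/imset2P; exists a b. Qed.
Definition point (a b : gT) : V := Sub [tuple a; b; a * b] (cell_point_proof a b).

Lemma coord_point a b :
  [/\ coord (point a b) 0%R = a, coord (point a b) 1%R = b
    & coord (point a b) 2%R = (a * b)^-1].
Proof. by []. Qed.

Lemma coord2 x : coord x 2%R = (coord x 0%R * coord x 1%R)^-1.
Proof.
case: x => t Lt; rewrite /coord /= /twist /=; congr _^-1.
by case/imset2P: Lt => a b _ _ ->.
Qed.

Lemma coord_prod x i : coord x i * coord x (i + 1)%R * coord x (i + 2)%R = 1.
Proof.
elim/I3_ind: i.
- by rewrite !add0r coord2 mulgV.
- have -> : (1 + 1)%R = 2%R :> 'I_3 by apply: val_inj.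
  have -> : (1 + 2)%R = 0%R :> 'I_3 by apply: val_inj.
  by rewrite coord2 invMg mulgA mulgV mul1g mulVg.
have -> : (2 + 1)%R = 0%R :> 'I_3 by apply: val_inj.
have -> : (2 + 2)%R = 1%R :> 'I_3 by apply: val_inj.
by rewrite coord2 -mulgA mulVg.
Qed.

Lemma coord_ext x x' : coord x =1 coord x' -> x = x'.
Proof.
by move=> E; apply/val_inj/eq_from_tnth=> i; apply: twist_inj (E i).
Qed.

Lemma I3_third (i j : 'I_3) : i != j -> j = (i + 1)%R \/ j = (i + 2)%R.
Proof.
by elim/I3_ind: i; elim/I3_ind: j => //; ((by left; apply: val_inj) || (by right; apply: val_inj)).
Qed.

Lemma coord_next2 x i : coord x (i + 2)%R = (coord x i * coord x (i + 1)%R)^-1.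
Proof. by apply: (mulgI (coord x i * coord x (i + 1)%R)); rewrite coord_prod mulgV. Qed.

Lemma coord_inj (i j : 'I_3) x x' : i != j ->
  coord x i = coord x' i -> coord x j = coord x' j -> x = x'.
Proof.
move=> ne_ij Ei Ej; have Ei1 : coord x (i + 1)%R = coord x' (i + 1)%R.
  have [<- //|Dj] := I3_third ne_ij; rewrite Dj in Ej.
  have := coord_prod x i; rewrite -(coord_prod x' i) Ei Ej => /mulIg/mulgI.
  by [].
apply: coord_ext => k; have [-> // | ne_ik] := eqVneq k i.
rewrite eq_sym in ne_ik.
by have [->|->] := I3_third ne_ik; rewrite ?coord_next2 ?Ei1 // Ei.
Qed.

Lemma coord_surj i a b : exists x, coord x i = a /\ coord x (i + 1)%R = b.
Proof.
elim/I3_ind: i.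
- by exists (point a b).
- exists (point (a * b)^-1 a); rewrite (_ : (1 + 1)%R = 2%R :> 'I_3); last exact: val_inj.
  have [_ -> ->] := coord_point (a * b)^-1 a.
  by rewrite !invMg !invgK mulKg.
exists (point b (a * b)^-1); rewrite (_ : (2 + 1)%R = 0%R :> 'I_3); last exact: val_inj.
have [-> _ ->] := coord_point b (a * b)^-1.
by rewrite !invMg !invgK mulgK.
Qed.

Lemma LSG_coord x x' : LSG x x' = (#|[set i | coord x i == coord x' i]| == 1%N).
Proof.
congr (_ == 1%N); apply: eq_card => i.
by rewrite !inE /coord (inj_eq (@twist_inj i)).
Qed.

Lemma LSGP x x' : reflect (x <> x' /\ exists i, coord x i = coord x' i) (LSG x x').
Proof.
rewrite LSG_coord; apply: (iffP cards1P) => [[i Di] | [ne_x [i Ei]]].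
  split; last by exists i; apply/eqP; move/setP/(_ i): Di; rewrite !inE eqxx.
  move=> Dx; have := congr1 (fun A : {set 'I_3} => (i + 1)%R \in A) Di.
  by rewrite Dx !inE eqxx; elim/I3_ind: (i).
exists i; apply/setP=> j; rewrite !inE; apply/idP/eqP => [/eqP Ej|->]; last by rewrite Ei.
apply/eqP/negPn/negP; rewrite eq_sym => ne_ij; case: ne_x; exact: coord_inj ne_ij Ei Ej.
Qed.

Definition coordwise (u : {perm V}) (f : 'I_3 -> gT -> gT) (s : 'S_3) : Prop :=
  (forall i, injective (f i)) /\ forall x i, coord (u x) (s i) = f i (coord x i).

Definition origin : V := point 1 1.

Lemma coord_origin i : coord origin i = 1.
Proof. by elim/I3_ind: i => //; rewrite coord2 /= !mulg1 invg1. Qed.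

Lemma coord_inv x (i j k : 'I_3) : i != j -> j != k -> i != k ->
  coord x i = 1 -> coord x k = (coord x j)^-1.
Proof.
move=> ne_ij ne_jk ne_ik xi1; have := coord_prod x i; rewrite xi1 mul1g.
have [Dj|Dj] := I3_third ne_ij; have [Dk|Dk] := I3_third ne_ik.
- by rewrite Dj Dk eqxx in ne_jk.
- by rewrite -Dj -Dk => /(canRL (mulKg _)); rewrite mulg1.
- by rewrite -Dj -Dk => /(canRL (mulgK _)); rewrite mul1g.
by rewrite Dj Dk eqxx in ne_jk.
Qed.

Lemma LSG_coordwise u f s x x' : coordwise u f s -> LSG (u x) (u x') = LSG x x'.
Proof.
case=> f_inj uf; apply/LSGP/LSGP => -[ne_x [i Ei]]; split.
- by move=> Dx; rewrite Dx in ne_x.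
- by exists (s^-1 i); apply: (f_inj (s^-1 i)); rewrite -!uf permKV.
- by move/perm_inj.
by exists (s i); rewrite !uf Ei.
Qed.

(** The vertex with entries b, b^-1, 1 at i, i + 1, i + 2 is sent to a vertex with entry 1 at s(i +
    2), whose other two entries are therefore mutually inverse. *)
Lemma coordwise_fix_inv u f s i b : coordwise u f s -> u origin = origin ->
  f (i + 1)%R b^-1 = (f i b)^-1.
Proof.
case=> _ uf uo; have f1 j : f j 1 = 1.
  by have := uf origin j; rewrite uo !coord_origin.
have [x [xi xj]] := coord_surj (i + 2)%R 1 b.
have Di3 : (i + 2 + 1)%R = i by elim/I3_ind: i {xi xj}; apply: val_inj.
rewrite {}Di3 in xj.
have xk : coord x (i + 1)%R = b^-1.
  by rewrite -xj; apply: (@coord_inv x (i + 2)%R) => //; elim/I3_ind: i {xi xj}.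
rewrite -[in LHS]xk -xj -!uf; apply: (@coord_inv _ (s (i + 2)%R)).
- by rewrite (inj_eq perm_inj); elim/I3_ind: i {xi xj xk}.
- by rewrite (inj_eq perm_inj); elim/I3_ind: i {xi xj xk}.
- by rewrite (inj_eq perm_inj); elim/I3_ind: i {xi xj xk}.
by rewrite uf xi f1.
Qed.

Definition central (u : {perm V}) (al : gT -> gT) (s : 'S_3) : Prop :=
  [/\ injective al, forall x i, coord (u x) (s i) = al (coord x i),
      forall b, al b^-1 = (al b)^-1
    & (forall b c, al (b * c) = al b * al c) \/ (forall b c, al (b * c) = al c * al b)].

(** Applying [coordwise_fix_inv] twice identifies the maps at i and i + 2, hence all three. The
    relation between the images of b, c and (bc)^-1 then makes the common map an automorphism or an
    antiautomorphism, according as s preserves or reverses the cyclic order. *)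
Lemma coordwise_fix u f s : coordwise u f s -> u origin = origin ->
  exists al, central u al s.
Proof.
move=> uf uo; have fV := coordwise_fix_inv _ _ uf uo.
have [f_inj {}uf] := uf.
have f2 i b : f (i + 2)%R b = f i b.
  have -> : (i + 2)%R = (i + 1 + 1)%R by elim/I3_ind: i; apply: val_inj.
  by rewrite -[in LHS](invgK b) fV fV invgK.
have f_next i b : f (i + 1)%R b = f i b.
  rewrite -(f2 i) -(f2 (i + 2)%R).
  by congr (f _ b); elim/I3_ind: i; apply: val_inj.
have f_all i b : f i b = f 0%R b.
  elim/I3_ind: i => //; last by rewrite -(f2 0%R) add0r.
  by rewrite -(f_next 0%R) add0r.
exists (f 0%R).
have aV b : f 0%R b^-1 = (f 0%R b)^-1 by rewrite -fV f_next.
have ua x i : coord (u x) (s i) = f 0%R (coord x i) by rewrite uf f_all.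
split=> //.
have s01 : s 0%R != s 1%R by rewrite (inj_eq perm_inj).
have s02 : s 0%R != s 2%R by rewrite (inj_eq perm_inj).
have s12 : s 1%R != s 2%R by rewrite (inj_eq perm_inj).
have [D1|D1] := I3_third s01; have [D2|D2] := I3_third s02.
- by rewrite D1 D2 eqxx in s12.
- left=> b c; have := coord_prod (u (point b c)) (s 0%R); rewrite -D1 -D2 !ua.
  by have [-> -> ->] := coord_point b c; rewrite aV => /(canRL (mulgKV _)); rewrite mul1g.
- right=> b c; have := coord_prod (u (point b c)) (s 0%R); rewrite -D1 -D2 !ua.
  have [-> -> ->] := coord_point b c; rewrite aV => /(canRL (mulgK _)).
  rewrite mul1g; move/(canRL (mulgKV _)); set A := f _ b => DA.
  by apply/esym; rewrite DA mulKVg.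
by rewrite D1 D2 eqxx in s12.
Qed.

(** * Consequences of arc-transitivity for the group H *)

Section ArcTransitive.

Variable G : {group {perm V}}.
Hypothesis coordG : forall u, u \in G -> exists f s, coordwise u f s.
Hypothesis arcG : arc_transitive (@LSG gT) G.
Hypothesis gT_gt1 : 1 < #|gT|.

Lemma exists_neq (a : gT) : exists b, b != a.
Proof.
have : 0 < #|[set~ a]| by rewrite cardsC1 -subn1 subn_gt0.
by case/card_gt0P=> b; rewrite !inE; exists b.
Qed.

Lemma LSG_neighbour i x b : b != coord x (i + 1)%R ->
  exists2 x', LSG x x' & coord x' i = coord x i /\ coord x' (i + 1)%R = b.
Proof.
move=> ne_b; have [x' [x'i x'j]] := coord_surj i (coord x i) b.
exists x' => //; apply/LSGP; split; last by exists i.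
by move=> Dx; case/eqP: ne_b; rewrite -x'j Dx.
Qed.

Lemma LSG_automorphism u x x' : u \in G -> LSG (u x) (u x') = LSG x x'.
Proof. by move/coordG=> [f [s /LSG_coordwise]]. Qed.

Lemma arc_vertex_transitive x x' : exists2 u, u \in G & u x = x'.
Proof.
have nbr (z : V) : exists z', LSG z z'.
  have [b /(LSG_neighbour (i := 0%R))[z']] := exists_neq (coord z (0 + 1)%R).
  by exists z'.
have [[z xz] [z' xz']] := (nbr x, nbr x').
by have [u Gu [ux _]] := arcG xz xz'; exists u.
Qed.

(** Move the arc from [origin] to the vertex with entries 1, a at i, i + 1 onto the arc to the
    vertex with entries 1, b at j, j + 1. The position i + 1 may go to j + 1 or to j + 2, where the
    entry is b or b^-1. *)
Lemma stab_arc (i j : 'I_3) a b : a != 1 -> b != 1 ->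
  exists2 u, u \in G & exists al s,
    [/\ central u al s, s i = j & al a = b \/ al a = b^-1].
Proof.
move=> a1 b1.
have [x ox [xi xj]] : exists2 x, LSG origin x & coord x i = coord origin i /\ coord x (i + 1)%R = a.
  by apply: LSG_neighbour; rewrite coord_origin.
have [z oz [zi zj]] : exists2 x, LSG origin x & coord x j = coord origin j /\ coord x (j + 1)%R = b.
  by apply: LSG_neighbour; rewrite coord_origin.
rewrite coord_origin in xi; rewrite coord_origin in zi.
have zj2 : coord z (j + 2)%R = b^-1.
  by rewrite -zj; apply: (@coord_inv z j) => //; elim/I3_ind: (j).
have [u Gu [uo ux]] := arcG ox oz; exists u => //.
have [f [s uf]] := coordG Gu; have [al cen_u] := coordwise_fix uf uo.
have [al_inj ual _ _] := cen_u; exists al, s.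
(* As b is not 1, j is the only position where z has entry 1. *)
have Dsi : s i = j.
  have z1 : coord z (s i) = 1 by rewrite -ux ual xi -(coord_origin i) -ual uo !coord_origin.
  apply/eqP/negPn/negP; rewrite eq_sym => ne_j; case/eqP: b1.
  have [D|D] := I3_third ne_j; move: z1; rewrite D ?zj ?zj2 //.
  by move/eqP; rewrite invg_eq1 => /eqP.
split=> //.
have := ual x (i + 1)%R; rewrite ux xj => <-.
have : j != s (i + 1)%R by rewrite -Dsi (inj_eq perm_inj); elim/I3_ind: (i).
by case/I3_third=> ->; [left | right].
Qed.

Lemma central_origin u al s : central u al s -> al 1 = 1 /\ u origin = origin.
Proof.
case=> _ ual _ alM; have al1 : al 1 = 1.
  by case: alM => alM; apply: (mulgI (al 1)); rewrite -alM !mulg1.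
by split=> //; apply: coord_ext => i; rewrite -(permKV s i) ual !coord_origin.
Qed.

Lemma centralX u al s : central u al s -> forall a n, al (a ^+ n) = al a ^+ n.
Proof.
move=> cen_u a; have [al1 _] := central_origin cen_u; case: cen_u => _ _ _ alM.
elim=> [|n IH]; first by rewrite !expg0.
by case: alM => alM; [rewrite !expgS | rewrite expgSr expgS]; rewrite alM IH // -expgS.
Qed.

Lemma central_commute u al s a b : central u al s -> commute a b -> commute (al a) (al b).
Proof. by case=> _ _ _ [] alM ab; rewrite /commute -!alM ab. Qed.

(** Stabiliser elements carry any nonidentity element to any other or to its inverse. Applied to an
    element of order p this gives exponent p; applied to a nontrivial element of the centre of the
    resulting p-group it gives commutativity. *)
Lemma arc_transitive_abelem : exists2 p, prime p & p.-abelem [set: gT].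
Proof.
pose p := pdiv #|gT|; have pr_p : prime p by apply: pdiv_prime.
have [a _ oa] : {a | a \in [set: gT] & #[a] = p} by apply: Cauchy; rewrite ?cardsT ?pdiv_dvd.
have a1 : a != 1 by rewrite -order_gt1 oa prime_gt1.
have expp (b : gT) : b ^+ p = 1.
  have [-> | b1] := eqVneq b 1; first by rewrite expg1n.
  have [u _ [al [s [cen_u _ Dal]]]] := stab_arc 0%R 0%R a1 b1.
  have := centralX cen_u a p; rewrite -oa expg_order (central_origin cen_u).1 oa.
  by case: Dal => -> => [<- //|/esym/eqP]; rewrite expVgn invg_eq1 => /eqP.
have pG : p.-group [set: gT].
  apply/pgroupP=> l pr_l /Cauchy[//|b _ ob]; rewrite inE /= -(dvdn_prime2 pr_l pr_p) -ob.
  by rewrite order_dvdn expp.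
have ntG : [set: gT] != 1 by rewrite trivg_card1 cardsT neq_ltn gT_gt1 orbT.
have [z Zz z1] : exists2 z, z \in 'Z([set: gT]) & z != 1.
  by apply/trivgPn; rewrite center_nil_eq1 ?(pgroup_nil pG).
exists p => //; apply/abelemP => //; split=> //; apply/centsP=> b _ c _.
have [-> | b1] := eqVneq b 1; first exact: commute_sym (commute1 _).
have [u _ [al [s [cen_u _ Dal]]]] := stab_arc 0%R 0%R z1 b1.
have [al' _ alK] := injF_bij (let: And4 h _ _ _ := cen_u in h).
have : commute (al z) c.
  rewrite -(alK c); apply: central_commute cen_u _.
  by case/setIP: Zz => _ /centP; apply; rewrite inE.
case: Dal => -> // bc; apply: commute_sym; rewrite -(invgK b).
exact: commuteV (commute_sym bc).
Qed.

End ArcTransitive.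
End Coordinates.

(** * Normal subgroups of arc-transitive groups *)

Section NormalSubgroup.
Variable gT : finGroupType.
Local Notation V := (cell gT).
Local Notation origin := (@origin gT).
Variables (p d : nat) (G N : {group {perm V}}).
Hypothesis coordG : forall u, u \in G -> exists f s, coordwise u f s.
Hypothesis arcG : arc_transitive (@LSG gT) G.
Hypotheses (pr_p : prime p) (cG : #|gT| = (p ^ d)%N) (d_gt0 : 0 < d).
Hypotheses (nNG : N <| G) (ntN : N :!=: 1).

Let gT_gt1 : 1 < #|gT|.
Proof. by rewrite cG -(exp1n d) ltn_exp2r // prime_gt1. Qed.

Let D : {set V} := orbit 'P N origin.

Lemma card_cell : #|V| = (#|gT| * #|gT|)%N.
Proof.
rewrite -card_prod; apply: bij_eq_card (fun x : V => (coord x 0%R, coord x 1%R)) _.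
exists (fun ab : gT * gT => point ab.1 ab.2) => [x|[a b] //].
apply: (@coord_inj _ 0%R 1%R) => //.
Qed.

Lemma orbit_normal u x : u \in G -> orbit 'P N (u x) = [set u z | z in orbit 'P N x].
Proof.
move=> Gu; have nNu := subsetP (normal_norm nNG) u Gu.
apply/setP=> z; apply/imsetP/imsetP => [[n Nn ->] | [z' /imsetP[n Nn ->] ->]].
  exists ((n ^ u^-1) x).
    by apply: (mem_orbit 'P); rewrite memJ_norm ?groupV.
  by rewrite /= apermE /conjg invgK !permM permKV. 
exists (n ^ u); first by rewrite memJ_norm.
by rewrite /= !apermE /conjg !permM permK.
Qed.

Lemma card_orbit_dvd : #|D| %| #|gT| * #|gT|.
Proof.
have acts : [acts N, on [set: V] | 'P] by apply/actsP=> n Nn x; rewrite !inE.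
have := card_uniform_partition _ (orbit_partition acts).
move/(_ #|D|); rewrite cardsT card_cell => -> //; first exact: dvdn_mull.
move=> _ /imsetP[x _ ->]; have [u Gu <-] := arc_vertex_transitive arcG gT_gt1 origin x.
by rewrite orbit_normal // card_imset //; apply: perm_inj.
Qed.

Lemma orbit_stab_stable u x : u \in G -> u origin = origin -> x \in D -> u x \in D.
Proof.
move=> Gu uo Dx; rewrite /D -uo orbit_normal //; exact: imset_f.
Qed.

Lemma orbit_nontrivial : exists2 x, x \in D & x != origin.
Proof.
apply/exists_inP; apply: contraNT ntN; rewrite negb_exists_in => /forall_inP D1.
rewrite -subG1; apply/subsetP=> n Nn; apply/set1gP/permP=> x; rewrite perm1.
have [u Gu <-] := arc_vertex_transitive arcG gT_gt1 origin x.
have nNu : n ^ u^-1 \in N by rewrite memJ_norm // groupV (subsetP (normal_norm nNG)).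
have /D1/negPn/eqP : (n ^ u^-1) origin \in D by apply: (mem_orbit 'P).
rewrite /conjg invgK !permM => /(canRL (permKV u)) ->.
by [].
Qed.

Lemma orbit_LSG_closed w z : w \in D -> (forall x, LSG origin x -> x \in D) -> LSG w z -> z \in D.
Proof.
case/imsetP=> n Nn ->; rewrite /= apermE => nbD nz.
have Gn := subsetP (normal_sub nNG) n Nn.
have /nbD Dz : LSG origin (n^-1 z) by rewrite -(LSG_automorphism coordG _ _ Gn) permKV.
by apply: orbit_trans Dz; rewrite -[X in X \in _](permKV n); apply: (mem_orbit 'P).
Qed.

(** The stabiliser of [origin] in G preserves [D] and is transitive on the neighbours of [origin],
    so [D] contains all of them and is closed under adjacency. Any vertex is reached from [origin]
    along two lines. *)
Lemma neighbour_orbit_transitive x : LSG origin x -> x \in D -> [transitive N, on [set: V] | 'P].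
Proof.
move=> ox Dx; have nbD z : LSG origin z -> z \in D.
  by move=> oz; have [u Gu [uo <-]] := arcG ox oz; apply: orbit_stab_stable.
have Do : origin \in D by apply: orbit_refl.
have D_row i (w z : V) : coord w i = coord z i -> w \in D -> z \in D.
  move=> Ei Dw; have [<- // | ne_w] := eqVneq w z.
  by apply: orbit_LSG_closed Dw nbD _; apply/LSGP; split; [apply/eqP | exists i].
apply/imsetP; exists origin; rewrite ?inE //; apply/esym/setP=> z; rewrite inE.
have [w [w0 w1]] := coord_surj 0%R 1 (coord z (0 + 1)%R).
by apply: (D_row _ _ _ w1); apply: (D_row 0%R _ _ _ Do); rewrite coord_origin.
Qed.

Lemma normal_orbit_dichotomy : [transitive N, on [set: V] | 'P] \/
  (forall i, {in D &, injective (fun x : V => coord x i)}) /\ #|D| = #|gT|.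
Proof.
have [tr | ntr] := boolP [transitive N, on [set: V] | 'P]; [by left | right].
have D_inj (i : 'I_3) : {in D &, injective (fun x : V => coord x i)}.
  move=> x x' Dx Dx' /= Ei; apply/eqP/negPn/negP=> ne_x.
  have /imsetP[n Nn Dnx] := Dx; rewrite /= apermE in Dnx.
  have Gn := subsetP (normal_sub nNG) n Nn.
  have/neighbour_orbit_transitive H: LSG origin (n^-1 x').
    rewrite -(LSG_automorphism coordG _ _ Gn) -Dnx permKV; apply/LSGP; split; last by exists i.
    by apply/eqP.
  case/negP: ntr; apply: H; apply: orbit_trans Dx'.
  by apply: (mem_orbit 'P); rewrite groupV.
split=> //; pose Y := [set coord x 0%R | x in D].
have cardY : #|Y| = #|D| by rewrite card_in_imset.
have Do : origin \in D by apply: orbit_refl.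
have Y1 : 1 \in Y by apply/imsetP; exists origin; rewrite ?coord_origin.
(* Stabiliser elements that fix position 0 preserve [Y] and carry a nonidentity element of it to b
   or b^-1. *)
have Y_or b : (b \in Y) || (b^-1 \in Y).
  have [-> | b1] := eqVneq b 1; first by rewrite Y1.
  have [x Dx ne_x] := orbit_nontrivial.
  have a1 : coord x 0%R != 1.
    apply: contraNneq ne_x => Ex; apply/eqP/(D_inj 0%R _ _ Dx Do).
    by rewrite Ex coord_origin.
  have [u Gu [al [s [cen_u s0 Dal]]]] := stab_arc coordG arcG 0%R 0%R a1 b1.
  have [_ uo] := central_origin cen_u; have [_ ual _ _] := cen_u.
  have : al (coord x 0%R) \in Y.
    by rewrite -ual s0; apply: imset_f; apply: orbit_stab_stable.
  by case: Dal => -> ->; rewrite ?orbT.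
have DT : [set: gT] = Y :|: [set b^-1 | b in Y].
  apply/setP=> b; rewrite !inE; have /orP[->// | Yb] := Y_or b.
  by apply/esym/orP; right; apply/imsetP; exists b^-1; rewrite ?invgK.
(* [Y] and its set of inverses cover H and share 1. Being a power of p above q/2 and at most q, the
   size of [D] is then q. *)
have lt_q : #|gT| < 2 * #|D|.
  have cardV : #|[set b^-1 | b in Y]| = #|Y| by apply: card_imset; apply: invg_inj.
  rewrite -cardsT DT cardsU cardV.
  have : 0 < #|Y :&: [set b^-1 | b in Y]|.
    apply/card_gt0P; exists 1; rewrite inE Y1; apply/imsetP; exists 1; rewrite ?invg1 //.
  by rewrite cardY mul2n -addnn; case: #|_ :&: _| => // k _;
    rewrite ltn_subrL /= addn_gt0 (cardD1 origin) Do.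
have le_q : #|D| <= #|gT| by rewrite -cardY max_card.
have := card_orbit_dvd; rewrite cG -expnD => /(dvdn_pfactor _ _ pr_p)[k _ Dk].
move: lt_q le_q; rewrite cG Dk leq_exp2l ?prime_gt1 // => lt_q.
rewrite leq_eqVlt => /predU1P[-> // | lt_kd]; move: lt_q.
rewrite ltnNge; case/negP; apply: leq_trans (leq_pexp2l (prime_gt0 pr_p) lt_kd).
by rewrite expnS leq_mul2r prime_gt1 ?orbT.
Qed.

Lemma normal_quotient_complete : complete_quotient (@LSG gT) N.
Proof.
move=> _ _ /imsetP[x _ ->] /imsetP[z _ ->] ne_xz; rewrite /quotient_adj ne_xz /=.
(* For transitive N there is only one orbit, and completeness is vacuous. *)
have [tr | [D_inj cardD]] := normal_orbit_dichotomy.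
  by move: ne_xz; rewrite !(atransP tr) ?inE // eqxx.
suffices [w Ow wx] : exists2 w, w \in orbit 'P N z & coord w 0%R = coord x 0%R.
  apply/exists_inP; exists x; first exact: orbit_refl.
  apply/exists_inP; exists w => //; apply/LSGP; split; last by exists 0%R.
  move=> Dx; case/eqP: ne_xz; apply/orbit_eqP; rewrite Dx //.
have [u Gu uoz] := arc_vertex_transitive arcG gT_gt1 origin z.
have [f [s [f_inj uf]]] := coordG Gu; pose i := s^-1 0%R.
have: [set f i (coord w i) | w in D] = [set: gT].
  apply/eqP; rewrite eqEcard subsetT cardsT card_in_imset ?cardD //=.
  by move=> w w' Dw Dw' /f_inj; apply: D_inj.
move/setP/(_ (coord x 0%R)); rewrite inE => /imsetP[w Dw ->].
exists (u w); first by rewrite -uoz orbit_normal //; apply: imset_f.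
by rewrite -uf permKV.
Qed.

End NormalSubgroup.

Lemma order3_transitive (s : 'S_3) (T : Type) (f : 'I_3 -> T) : #[s] = 3 ->
  (forall i, f (s i) = f i) -> forall i j, f i = f j.
Proof.
move=> os fs; have s3 i : s (s (s i)) = i.
  by have := expg_order s; rewrite os => /permP/(_ i); rewrite !permM perm1.
have s_inj := @perm_inj _ s.
have third (i j k l : 'I_3) : i != j -> i != k -> j != k -> l != i -> l != j -> l = k.
  by elim/I3_ind: i; elim/I3_ind: j; elim/I3_ind: k; elim/I3_ind: l.
have no_fix i : s i != i.
  apply/negP=> /eqP si.
  (* If s fixes i, it preserves the other two points, so s^2 fixes them; with s^3 = 1 so does s. *)
  have s1 j : s j = j.
    have [-> // | ne_ji] := eqVneq j i; have [// | ne_sj] := eqVneq (s j) j.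
    have sj_i : s j != i by rewrite -[X in _ != X]si (inj_eq s_inj).
    have ssj : s (s j) = j.
      apply: (third i (s j)) => //; first by rewrite eq_sym.
      - by rewrite eq_sym.
      - by rewrite -[X in _ != X]si (inj_eq s_inj).
      by rewrite (inj_eq s_inj).
    by have := s3 j; rewrite ssj => Dj; rewrite Dj eqxx in ne_sj.
  have : s = 1 by apply/permP=> j; rewrite perm1.
  by move=> Ds; rewrite Ds order1 in os.
suffices f0 i : f i = f 0%R by move=> i j; rewrite !f0.
have [-> // | ne_i0] := eqVneq i 0%R; have [-> | ne_is] := eqVneq i (s 0%R); first by rewrite fs.
rewrite (third 0%R (s 0%R) (s (s 0%R)) i) ?fs // 1?eq_sym ?no_fix //.
  by apply/eqP=> E; have := s3 0%R; rewrite E; apply/eqP.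
Qed.

(** * Quasiprimitivity when p = 2 mod 3, d is odd and 3 does not divide d *)

Section Quasiprimitive.
Variable gT : finGroupType.
Local Notation V := (cell gT).
Local Notation origin := (@origin gT).
Variables (p d : nat) (G : {group {perm V}}).
Hypothesis coordG : forall u, u \in G -> exists f s, coordwise u f s.
Hypothesis arcG : arc_transitive (@LSG gT) G.
Hypotheses (pr_p : prime p) (abG : p.-abelem [set: gT]).
Hypotheses (cG : #|gT| = (p ^ d)%N) (d_gt0 : 0 < d).
Hypotheses (p2 : p = 2 %[mod 3]) (odd_d : odd d) (d3 : ~~ (3 %| d)).

Let gT_gt1 : 1 < #|gT|.
Proof. by rewrite cG -(exp1n d) ltn_exp2r // prime_gt1. Qed.

Let gTC (a b : gT) : a * b = b * a.
Proof. by have /abelem_abelian/centsP := abG; apply; rewrite inE. Qed.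

Definition central_pair (w : {perm gT} * 'S_3) (u : {perm V}) : bool :=
  [forall x, forall i, coord (u x) (w.2 i) == w.1 (coord x i)].

(** The stabiliser of [origin] is encoded in a direct product, so that its actions on H and on the
    coordinates are the two projection morphisms. *)
Definition central_pairs : {set {perm gT} * 'S_3} :=
  [set w | (w.1 \in Aut [set: gT]) && [exists u in G, central_pair w u]].

Lemma central_pairsP (w : {perm gT} * 'S_3) : reflect (w.1 \in Aut [set: gT] /\
    exists2 u, u \in G & forall x i, coord (u x) (w.2 i) = w.1 (coord x i))
  (w \in central_pairs).
Proof.
rewrite [in X in reflect _ X]in_set; apply: (iffP andP) => -[Aw].
  case/exists_inP=> u Gu /forallP uw; split=> //; exists u => // x i.
  by apply/eqP; apply: (forallP (uw x)).
case=> u Gu uw; split=> //; apply/exists_inP; exists u => //.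
by apply/forallP=> x; apply/forallP=> i; rewrite uw.
Qed.

Lemma central_pairs_group_set : group_set central_pairs.
Proof.
apply/group_setP; split=> [|w w' /central_pairsP[Aw [u Gu uw]] /central_pairsP[Aw' [u' Gu' uw']]].
  apply/central_pairsP; split; first exact: group1.
  by exists 1 => [|x i]; rewrite ?group1 // !perm1.
apply/central_pairsP; split; first exact: groupM.
by exists (u * u') => [|x i]; rewrite ?groupM // !permM uw' uw.
Qed.
Canonical central_pairs_group := Group central_pairs_group_set.

Lemma central_mem_pairs u al s : u \in G -> central u al s ->
  exists2 w, w \in central_pairs & w.2 = s /\ w.1 =1 al.
Proof.
move=> Gu [al_inj ual _ alM]; exists (perm al_inj, s); last by split=> // a; rewrite permE.
apply/central_pairsP; split; last by exists u => // x i; rewrite permE ual.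
rewrite inE; apply/andP; split; first by apply/subsetP=> a; rewrite inE.
by apply/morphicP=> a b _ _; rewrite !permE; case: alM => -> //; apply: gTC.
Qed.

Lemma exists_rotation : exists2 u, u \in G & exists2 s : 'S_3, #[s] = 3 &
  forall x i, coord (u x) (s i) = coord x i.
Proof.
have [w Sw [w1 ow]] : exists2 w, w \in central_pairs_group & w.1 = 1 /\ #[w.2] = 3.
  apply: (exists_trivial_aut abG cG) => // [w /central_pairsP[]//|a b a1 b1|].
    have [u Gu [al [s [cen_u _ Dal]]]] := stab_arc coordG arcG 0%R 0%R a1 b1.
    have [w Sw [_ w1]] := central_mem_pairs Gu cen_u.
    by exists w; rewrite ?w1.
  (* The stabiliser permutes the three coordinates transitively, so 3 divides the order of the
     induced group. *)
  have [c /morphimP[w _ Sw ->] oc] : {c | c \in snd @* central_pairs_group & #[c] = 3}.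
    apply: Cauchy => //; apply: dvdn_trans (dvdn_orbit 'P _ (0%R : 'I_3)).
    suffices -> : orbit 'P (snd @* central_pairs_group) (0%R : 'I_3) = [set: 'I_3].
      by rewrite cardsT card_ord.
    apply/setP=> j; rewrite inE.
    have [b b1] := exists_neq gT_gt1 1.
    have [u Gu [al [s [cen_u sj _]]]] := stab_arc coordG arcG 0%R j b1 b1.
    have [w Sw [w2 _]] := central_mem_pairs Gu cen_u.
    rewrite -sj -w2; apply: (mem_orbit (@perm_action _)).
    by apply: (mem_morphim [morphism of snd]); rewrite ?in_setT.
  by exists w.
have /central_pairsP[_ [u Gu uw]] := Sw; exists u => //; exists w.2 => // x i.
by rewrite uw w1 perm1.
Qed.

Lemma normal_transitive (N : {group {perm V}}) : N <| G -> N :!=: 1 -> [transitive N, on [set: V] | 'P].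
Proof.
move=> nNG ntN; have [// | [D_inj cardD]] := normal_orbit_dichotomy coordG arcG pr_p cG d_gt0 nNG ntN.
have [u Gu [s os us]] := exists_rotation.
set D := orbit 'P N origin in D_inj cardD.
pose S := D :\ origin.
have uo : u origin = origin.
  by apply: coord_ext => i; rewrite -(permKV s i) us !coord_origin.
have u3 x : u (u (u x)) = x.
  apply: coord_ext => i; have s3 : s (s (s i)) = i.
    by have := expg_order s; rewrite os => /permP/(_ i); rewrite !permM perm1.
  by rewrite -[in LHS]s3 !us.
have uS x : x \in S -> u x \in S.
  rewrite !inE => /andP[x1 Dx]; rewrite (orbit_stab_stable nNG Gu uo Dx) andbT.
  by rewrite -[X in _ != X]uo (inj_eq perm_inj).
have actS : [acts <[u]>, on S | 'P].
  rewrite /acts_on cycle_subG; apply/astabsP=> x; rewrite /= apermE.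
  by apply/idP/idP=> [Sux|/uS //]; rewrite -(u3 x); apply/uS/uS.
have p3u : 3.-group <[u]>.
  apply: (pnat_dvd (_ : _ %| 3)%N) => //; rewrite -orderE order_dvdn.
  by apply/eqP/permP=> x; rewrite !permM perm1 u3.
(* The 3-group generated by u acts on the q - 1 = 1 mod 3 points of [S], so it fixes one. *)
have [x /setIP[Sx Fx]] : exists x, x \in 'Fix_(S | 'P)(<[u]>).
  apply/set0Pn; apply: contraTneq isT => F0.
  have := pgroup_fix_mod p3u actS; rewrite F0 cards0.
  have -> : #|S| = (p ^ d - 1)%N.
    by rewrite -cG -cardD (cardsD1 origin D) orbit_refl addKn.
  have q_gt0 : 0 < p ^ d by rewrite expn_gt0 prime_gt0.
  have : (p ^ d - 1).+1 = 2 %[mod 3] by rewrite subn1 prednK // expn_odd_mod3.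
  by move=> E /eqP; rewrite -(eqn_modDr 1) addn1 E.
have ux : u x = x by move/afixP/(_ u (cycle_id u)): Fx; rewrite /= apermE.
have coord_s i : coord x (s i) = coord x i by rewrite -[in LHS]ux us.
have coord_const := order3_transitive os coord_s.
pose a := coord x 0%R.
have a3 : a ^+ 3 = 1.
  rewrite -(coord_prod x 0%R) !(coord_const _ 0%R).
  by rewrite !expgS expg0 mulg1 mulgA.
have ap : a ^+ p = 1 by have /abelemP[//|_ ->] := abG; rewrite ?inE.
have a1 : a = 1.
  apply/eqP; rewrite -order_eq1 -dvdn1.
  have co3p : coprime 3 p by rewrite prime_coprime // /dvdn p2.
  by rewrite -(eqP co3p) dvdn_gcd !order_dvdn a3 ap !eqxx.
move: Sx; rewrite !inE => /andP[/eqP[]]; apply: coord_ext => i.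
by rewrite (coord_const i 0%R) coord_origin.
Qed.
End Quasiprimitive.

(** * Quotient-complete examples *)

Section StableLines.
Local Open Scope ring_scope.

(* The vector w spans a line of F^3 that lies in the plane of sum zero and is
   stable under the s-semilinear cyclic shift. *)
Definition shift_stable_line (F : finFieldType) (s : F -> F) (w : 'I_3 -> F) (c : F) :=
  [/\ {morph s : x y / x + y}, {morph s : x y / x * y}, injective s,
      w 0 + w 1 + w 2%R = 0 & w 0 != 0 /\ c != 0 /\ forall i, s (w i) = c * w (i + 1)].

Lemma root_shift_stable_line (F : finFieldType) (z : F) : 1 + z + z ^+ 2 = 0 ->
  exists s w c, @shift_stable_line F s w c.
Proof.
move=> z1; have z3 : z ^+ 3 = 1.
  have E : z ^+ 3 - 1 = (z - 1) * (1 + z + z ^+ 2) by ring.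
  by apply/eqP; rewrite -subr_eq0 E z1 mulr0.
(* The entries 1, z^2, z are ordered so that the shift multiplies by z. *)
exists id, (fun i => if i == 0 then 1 else if i == 1 then z ^+ 2 else z), z.
split=> //=; first by rewrite addrAC.
rewrite oner_eq0; split=> //; split.
  by apply: contra_eq_neq z3 => ->; rewrite expr0n eq_sym oner_eq0.
by elim/I3_ind=> /=; rewrite ?mulr1 // -?exprS ?z3 // -expr2.
Qed.

Lemma exists_root (p d : nat) (F : finFieldType) : prime p -> (0 < d)%N -> #|F| = (p ^ d)%N ->
  (p ^ d != 2 %[mod 3])%N -> exists z : F, 1 + z + z ^+ 2 = 0.
Proof.
move=> pr_p d_gt0 cF q2.
have [p3 | p_neq3] := eqVneq p 3%N.
  (* In characteristic 3 the root is 1; otherwise q = 1 mod 3 and an element of order 3 of the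
     multiplicative group is a root. *)
  exists 1; have := card_finPcharP cF pr_p; rewrite p3 => /pcharf0 F3.
  by rewrite expr1n -[RHS]F3; ring.
have : (3 %| #|[set: {unit F}]|)%N.
  rewrite card_finField_unit cF -subn1 -eqn_mod_dvd ?expn_gt0 ?prime_gt0 //.
  have : (p ^ d %% 3 != 0)%N.
    rewrite -[_ == _]/(3 %| p ^ d)%N Euclid_dvdX // d_gt0 andbT.
    by rewrite dvdn_prime2 // eq_sym.
  by move: q2; rewrite (modn_small (isT : 1 < 3)%N) (modn_small (isT : 2 < 3)%N); case: (_ %% 3)%N (ltn_pmod (p ^ d) (isT : 0 < 3)%N) => [|[|[|]]].
case/Cauchy=> // u _ ou; exists (val u).
have u3 : val u ^+ 3 = 1 by rewrite -FinRing.val_unitX -ou expg_order.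
have u1 : val u - 1 != 0.
  rewrite subr_eq0; apply/eqP=> u1; have : u = 1%g by apply: val_inj.
  by move=> Du; rewrite Du order1 in ou.
apply: (mulfI u1); rewrite mulr0.
have -> : (val u - 1) * (1 + val u + val u ^+ 2) = val u ^+ 3 - 1 by ring.
by rewrite u3 subrr.
Qed.

Lemma Frobenius_shift_stable_line (p m : nat) (F : finFieldType) : prime p -> (0 < m)%N ->
  #|F| = (p ^ (3 * m))%N -> exists s w c, @shift_stable_line F s w c.
Proof.
move=> pr_p m_gt0 cF; have pchF := card_finPcharP cF pr_p.
pose q := (p ^ m)%N; have cFq : #|F| = (q ^ 3)%N by rewrite cF mulnC expnM.
pose s (x : F) := x ^+ q.
have q_gt1 : (1 < q)%N by rewrite -(exp1n m) ltn_exp2r // prime_gt1.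
have s3 x : s (s (s x)) = x by rewrite /s -!exprM -[RHS]expf_card cFq !expnS expn0 muln1 mulnA.
have sD : {morph s : x y / x + y}.
  move=> x y; rewrite /s exprDn_pchar // pnatX; apply/orP; left.
  by rewrite pnatE.
have sM : {morph s : x y / x * y} by move=> x y; rewrite /s exprMn.
(* The fixed points of s are roots of X^q - X, and q < q^3. *)
have [v sv] : exists v, s v != v.
  apply/existsP; rewrite -negb_forall; apply/negP=> /forallP sid.
  have : ('X^q - 'X : {poly F}) != 0.
    by rewrite -size_poly_eq0 size_polyDl ?size_polyXn // size_polyN size_polyX ltnS.
  move/max_poly_roots/(_ _ (enum_uniq F)).
  rewrite size_polyDl ?size_polyXn ?size_polyN ?size_polyX ?ltnS // -cardE cFq.
  suffices -> : all (root ('X^q - 'X)) (enum F).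
    move/(_ isT); rewrite leqNgt => /negP; apply.
    by rewrite -{1}[q]expn1 ltn_exp2l.
  by apply/allP=> x _; rewrite /root !hornerE subr_eq0; apply: sid.
(* An element of this form has trace zero because s has order 3. *)
pose u := s v - v.
have sB : {morph s : x y / x - y}.
  by move=> x y; apply: (addIr (s y)); rewrite -sD !subrK.
exists s, (fun i : 'I_3 => iter i s u), 1; split=> //.
- by apply: (@can_inj _ _ _ (s \o s)) => x; apply: s3.
- by rewrite /= /u !sB s3; ring.
rewrite /= subr_eq0 sv oner_eq0; split=> //; split=> // i.
by elim/I3_ind: i => /=; rewrite mul1r.
Qed.

Lemma exists_shift_stable_line (p d : nat) : prime p -> (0 < d)%N -> arithmetic_condition p d ->
  exists F : finFieldType, #|F| = (p ^ d)%N /\ exists s w c, @shift_stable_line F s w c.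
Proof.
move=> pr_p d_gt0 arith; have [F _ cF] := pPrimePowerField pr_p d_gt0.
exists F; split=> //.
have [/dvdnP[m Dd] | d3] := boolP (3 %| d)%N.
  apply: (@Frobenius_shift_stable_line p m) => //; last by rewrite cF Dd mulnC.
  by move: d_gt0; rewrite Dd muln_gt0 => /andP[].
have [|z] := @exists_root p d F pr_p d_gt0 cF; last exact: root_shift_stable_line.
(* For even d this is applied to a = p^2, which is 0 or 1 modulo 3. *)
have pow01 a k : (0 < k)%N -> (a %% 3 < 2)%N -> (a ^ k != 2 %[mod 3])%N.
  move=> k_gt0; rewrite -modnXm; case: (a %% 3)%N => [|[|//]] _.
    by rewrite exp0n.
  by rewrite exp1n.
case: arith => [p2|ev_d|d0].
- apply: pow01 => //; move/eqP: p2; rewrite (modn_small (isT : 2 < 3)%N).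
  by case: (p %% 3)%N (ltn_pmod p (isT : 0 < 3)%N) => [|[|[|]]].
- rewrite -(odd_double_half d) (negPf ev_d) add0n -mul2n expnM.
  apply: pow01; first by rewrite half_gt0; case: (d) d_gt0 ev_d => [|[|]].
  by rewrite -modnXm; case: (p %% 3)%N (ltn_pmod p (isT : 0 < 3)%N) => [|[|[|]]].
by rewrite /dvdn d0 in d3.
Qed.

End StableLines.

Section Induced.
Variable gT : finGroupType.
Local Notation V := (cell gT).

Lemma induced_groupP (G : {group {perm 3.-tuple gT}}) (u : {perm V}) :
    G \subset autoparatopism gT ->
  reflect (exists2 t, t \in G & forall x, val (u x) = t (val x)) (u \in induced_group G).
Proof.
move=> sGA; have dom t : t \in G -> t \in subact_dom (mem (cayley_table gT)) 'P.
  by move/(subsetP sGA)/(subsetP (autoparatopism_dom gT)).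
apply: (iffP morphimP) => [[t Dt Gt ->] | [t Gt Du]]; exists t => //.
- by move=> x; rewrite actpermE /= val_subact Dt.
- exact: dom.
by apply/permP=> x; apply: val_inj; rewrite Du actpermE /= val_subact dom.
Qed.

Lemma induced_coordwise (G : {group {perm 3.-tuple gT}}) (u : {perm V}) :
    G \subset autoparatopism gT -> u \in induced_group G ->
  exists f s, coordwise u f s.
Proof.
move=> sGA /(induced_groupP _ sGA)[t Gt Du]; have := subsetP sGA t Gt.
rewrite inE => /andP[/existsP[f /existsP[s /forallP Dt]] _].
exists (fun i h => twist (s i) (f i (twist i h))), s; split=> [i h h'|x i].
  by move/twist_inj/perm_inj/twist_inj.
by rewrite /coord Du (eqP (Dt _)) tnth_mktuple permK twistK.
Qed.

(** An autoparatopism acts on all of H^3, while [coord] lives on the Cayley table and inverts the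
    third entry. Conjugating the maps by [twist] passes from one to the other. *)
Lemma coord_autoparatopism (f : 'I_3 -> {perm gT}) (s : 'S_3) :
    (forall x : V, exists x' : V, forall i, coord x' (s i) = f i (coord x i)) ->
  exists2 t, t \in autoparatopism gT &
    forall x x' : V, (forall i, coord x' (s i) = f i (coord x i)) -> t (val x) = val x'.
Proof.
move=> ex_f.
have tw_inj i : injective (fun h => twist (s i) (f i (twist i h))).
  by move=> h h' /twist_inj/perm_inj/twist_inj.
pose g := [ffun i => perm (@tw_inj i)].
have pa_inj : injective (product_action g s).
  move=> x x' E; apply/eq_from_tnth=> i.
  move: (congr1 (fun t => tnth t (s i)) E); rewrite !tnth_mktuple permK.
  exact: perm_inj.
have tE (x x' : V) : (forall i, coord x' (s i) = f i (coord x i)) -> perm pa_inj (val x) = val x'.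
  move=> xx'; apply/eq_from_tnth=> j; rewrite permE tnth_mktuple ffunE permE permKV.
  apply: (@twist_inj _ j); rewrite twistK.
  have := xx' (s^-1 j); rewrite permKV => <-; rewrite //.
exists (perm pa_inj) => //; rewrite inE; apply/andP; split.
  by apply/existsP; exists g; apply/existsP; exists s; apply/forallP=> x; rewrite permE.
rewrite eqEcard card_imset ?leqnn ?andbT; last exact: perm_inj.
apply/subsetP=> _ /imsetP[x Lx ->]; have [x' xx'] := ex_f (Sub x Lx).
by rewrite -[x]/(val (Sub x Lx : V)) (tE _ _ xx') (valP x').
Qed.

End Induced.

(** * The group permuting the cosets of a stable line *)

Section Construction.
Variable gT : finGroupType.
Local Notation V := (cell gT).
Local Notation origin := (@origin gT).
Variables (F : finFieldType) (e : gT -> F) (g : F -> gT).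
Hypotheses (eK : cancel e g) (gK : cancel g e).
Hypothesis eM : forall a b, e (a * b) = (e a + e b)%R.
Variables (sg : F -> F) (w : 'I_3 -> F) (c : F).
Hypothesis line : shift_stable_line sg w c.

Local Open Scope ring_scope.

Let e1 : e 1%g = 0.
Proof. by apply: (addrI (e 1%g)); rewrite -eM mulg1 addr0. Qed.

Let eV a : e a^-1%g = - e a.
Proof. by apply: (addrI (e a)); rewrite -eM mulgV e1 subrr. Qed.

Definition phi (x : V) (i : 'I_3) : F := e (coord x i).

Lemma sum_I3 (v : 'I_3 -> F) : \sum_i v i = v 0 + v 1 + v 2.
Proof.
rewrite !big_ord_recl big_ord0 addr0 addrA.
by congr (v _ + v _ + v _); apply: val_inj.
Qed.

Lemma phi_sum x : \sum_i phi x i = 0.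
Proof. by rewrite sum_I3 /phi coord2 eV eM subrr. Qed.

Lemma phi_inj x x' : phi x =1 phi x' -> x = x'.
Proof. by move=> E; apply: coord_ext => i; apply: (can_inj eK); apply: E. Qed.

Lemma phi_surj (v : 'I_3 -> F) : \sum_i v i = 0 -> exists x, phi x =1 v.
Proof.
rewrite sum_I3 => v0; exists (point (g (v 0)) (g (v 1))).
have [p0 p1 p2] := coord_point (g (v 0)) (g (v 1)).
elim/I3_ind; rewrite /phi ?p0 ?p1 ?p2 ?eV ?eM !gK //.
by apply/esym/eqP; rewrite -addr_eq0 addrC v0.
Qed.

Lemma phi_origin i : phi origin i = 0.
Proof. by rewrite /phi coord_origin. Qed.

(* The fibres of proj are the cosets of the line spanned by w. *)
Definition proj (t : 3.-tuple gT) : F := w 1 * e (tnth t 0) - w 0 * e (tnth t 1).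

Lemma projE (x : V) : proj (val x) = w 1 * phi x 0 - w 0 * phi x 1.
Proof. by []. Qed.

(** Sending fibres of [proj] into fibres is closed under products, which on a finite set already
    gives a group. *)
Definition fibre_group : {set {perm 3.-tuple gT}} :=
  [set t in autoparatopism gT | [forall x : V, forall x' : V,
     (proj (val x) == proj (val x')) ==> (proj (t (val x)) == proj (t (val x')))]].

Lemma autoparatopism_cell t (x : V) : t \in autoparatopism gT -> exists z : V, t (val x) = val z.
Proof.
rewrite inE => /andP[_ /eqP Lt].
have Ltx : t (val x) \in cayley_table gT.
  by move/setP/(_ (t (val x))): Lt => <-; apply: imset_f; apply: valP x.
by exists (Sub (t (val x)) Ltx).
Qed.

Lemma fibre_groupP t : reflect (t \in autoparatopism gT /\
    forall x x' : V, proj (val x) = proj (val x') -> proj (t (val x)) = proj (t (val x')))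
  (t \in fibre_group).
Proof.
rewrite [in X in reflect _ X]in_set; apply: (iffP andP) => -[At Pt]; split=> //.
  by move=> x x' /eqP Ex; apply/eqP; apply: (implyP (forallP (forallP Pt x) x')).
by apply/forallP=> x; apply/forallP=> x'; apply/implyP=> /eqP /Pt/eqP.
Qed.

Lemma fibre_group_set : group_set fibre_group.
Proof.
apply/group_setP; split=> [|t t' /fibre_groupP[At Pt] /fibre_groupP[At' Pt']].
  by apply/fibre_groupP; split=> [|x x']; rewrite ?group1 // !perm1.
apply/fibre_groupP; split=> [|x x' Ex]; first exact: groupM.
have [[z Dz] [z' Dz']] := (autoparatopism_cell x At, autoparatopism_cell x' At).
by rewrite !permM Dz Dz'; apply: Pt'; rewrite -Dz -Dz'; apply: Pt.
Qed.
Canonical fibre_group_group := Group fibre_group_set.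

Let G := induced_group fibre_group_group.

Lemma fibre_group_sub : fibre_group \subset autoparatopism gT.
Proof. by apply/subsetP=> t /fibre_groupP[]. Qed.

Lemma fibre_group_proj u x x' : u \in G -> proj (val x) = proj (val x') ->
  proj (val (u x)) = proj (val (u x')).
Proof.
case/(induced_groupP _ fibre_group_sub)=> t /fibre_groupP[_ Pt] Du Ex.
by rewrite !Du; apply: Pt.
Qed.

Lemma coord_map_mem (h : 'I_3 -> F -> F) (s : 'S_3) : (forall i, injective (h i)) ->
    (forall x, \sum_i h i (phi x i) = 0) ->
    (forall x x' z z', (forall i, phi z (s i) = h i (phi x i)) ->
       (forall i, phi z' (s i) = h i (phi x' i)) ->
       proj (val x) = proj (val x') -> proj (val z) = proj (val z')) ->
  exists2 u, u \in G & forall x i, phi (u x) (s i) = h i (phi x i).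
Proof.
move=> h_inj h_sum h_proj.
have f_inj i : injective (fun a => g (h i (e a))).
  by move=> a b /(can_inj gK)/h_inj/(can_inj eK).
have ex_z x : exists z, forall i, phi z (s i) = h i (phi x i).
  have [|z Dz] := @phi_surj (fun j => h (s^-1 j)%g (phi x (s^-1 j)%g)).
    rewrite (reindex_inj (@perm_inj _ s)) -[RHS](h_sum x).
    by apply: eq_bigr => i _; rewrite permK.
  by exists z => i; rewrite Dz permK.
have ph (z x : V) i : phi z (s i) = h i (phi x i) <-> coord z (s i) = perm (@f_inj i) (coord x i).
  by rewrite permE; split=> [<-|Ez]; [rewrite eK | rewrite /phi Ez gK].
have [|t At Dt] := @coord_autoparatopism gT (fun i => perm (@f_inj i)) s.
  by move=> x; have [z Dz] := ex_z x; exists z => i; apply/ph.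
have tE (x z : V) : (forall i, phi z (s i) = h i (phi x i)) -> t (val x) = val z.
  by move=> Dz; apply: Dt => i; apply/ph.
have Gt : t \in fibre_group.
  apply/fibre_groupP; split=> // x x'; have [[z Dz] [z' Dz']] := (ex_z x, ex_z x').
  by rewrite (tE _ _ Dz) (tE _ _ Dz'); apply: h_proj.
have dom : t \in subact_dom (mem (cayley_table gT)) 'P.
  exact: (subsetP (autoparatopism_dom gT)).
exists (actperm (subaction V 'P) t); first exact: mem_morphim.
move=> x i; have [z Dz] := ex_z x; rewrite -Dz; congr phi.
by apply: val_inj; rewrite actpermE /= val_subact dom /= apermE (tE _ _ Dz).
Qed.

Lemma translation_mem (b : 'I_3 -> F) : \sum_i b i = 0 ->
  exists2 u, u \in G & forall x i, phi (u x) i = phi x i + b i.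
Proof.
move=> b0; have [||x x' z z' Dz Dz'|u Gu Du] := @coord_map_mem (fun i v => v + b i) 1%g.
- by move=> i v v' /addIr.
- by move=> x; rewrite big_split /= phi_sum b0 addr0.
- have {}Dz i : phi z i = phi x i + b i by have := Dz i; rewrite perm1.
  have {}Dz' i : phi z' i = phi x' i + b i by have := Dz' i; rewrite perm1.
  have shiftE u v : w 1 * (u + b 0) - w 0 * (v + b 1)
      = (w 1 * u - w 0 * v) + (w 1 * b 0 - w 0 * b 1) by ring.
  by rewrite !projE !Dz !Dz' !shiftE => ->.
by exists u => // x i; rewrite -Du perm1.
Qed.

Lemma scaling_mem (a : F) : a != 0 ->
  exists2 u, u \in G & forall x i, phi (u x) i = a * phi x i.
Proof.
move=> a0; have [||x x' z z' Dz Dz'|u Gu Du] := @coord_map_mem (fun i v => a * v) 1%g.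
- by move=> i v v' /(mulfI a0).
- by move=> x; rewrite -mulr_sumr phi_sum mulr0.
- have {}Dz i : phi z i = a * phi x i by have := Dz i; rewrite perm1.
  have {}Dz' i : phi z' i = a * phi x' i by have := Dz' i; rewrite perm1.
  rewrite !projE !Dz !Dz' => E.
  by rewrite !(mulrCA _ a) -!mulrBr E.
by exists u => // x i; rewrite -Du perm1.
Qed.

Definition shift : 'S_3 := perm (@addIr 'I_3 1).

Lemma rotation_mem : exists2 u, u \in G & forall x i, phi (u x) (i + 1) = sg (phi x i).
Proof.
have [sD sM s_inj w0 [wnz [cnz sw]]] := line.
have s0 : sg 0 = 0 by apply: (addrI (sg 0)); rewrite -sD !addr0.
have sN v : sg (- v) = - sg v by apply: (addrI (sg v)); rewrite -sD !subrr.
have [||x x' z z' Dz Dz'|u Gu Du] := @coord_map_mem (fun i v => sg v) shift.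
- by [].
- by move=> x; rewrite sum_I3 -!sD -sum_I3 phi_sum.
(* Since w has sum zero and sg(w_i) = c w_(i+1), the semilinear shift changes [proj] only by sg and
   the factor c. *)
- have proj_z y y' : (forall i, phi y' (shift i) = sg (phi y i)) ->
      c * proj (val y') = sg (proj (val y)).
    move=> Dy; have {}Dy i : phi y' (i + 1) = sg (phi y i) by rewrite -Dy permE.
    have y'0 : phi y' 0 = sg (phi y 2) by rewrite -Dy; congr phi; apply: val_inj.
    have y'1 : phi y' 1 = sg (phi y 0) by rewrite -Dy add0r.
    have sw0 : sg (w 0) = c * w 1 by rewrite sw add0r.
    have sw1 : sg (w 1) = c * w 2 by rewrite sw; congr (_ * w _); apply: val_inj.
    have y2 : phi y 2 = - (phi y 0 + phi y 1).
      by apply/eqP; rewrite -addr_eq0 addrC -sum_I3 phi_sum.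
    have w2 : w 2 = - (w 0 + w 1) by apply/eqP; rewrite -addr_eq0 addrC w0.
    rewrite !projE y'0 y'1 y2 sD sN sM !sN sM sD sw0 sw1 w2; ring.
  move=> E; apply: (mulfI cnz); rewrite (proj_z x) // (proj_z x') //.
  by rewrite E.
by exists u => // x i; rewrite -Du permE.
Qed.

(** With n = (0, 1, -1), a rotation moves the entry 0 to the coordinate i shared by x and x', a
    scaling adjusts the difference at i + 1, and a translation carries [origin] to x. *)
Lemma arc_from_origin : exists n : V, forall x x', LSG x x' ->
  exists2 u, u \in G & u origin = x /\ u n = x'.
Proof.
have [sD sM s_inj w0 [wnz [cnz sw]]] := line.
have s0 : sg 0 = 0 by apply: (addrI (sg 0)); rewrite -sD !addr0.
have sN v : sg (- v) = - sg v by apply: (addrI (sg v)); rewrite -sD !subrr.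
have s1 : sg 1 = 1.
  have s1_neq0 : sg 1 != 0 by rewrite -s0 (inj_eq s_inj) oner_eq0.
  by apply: (mulfI s1_neq0); rewrite -sM !mulr1.
pose base i (z : V) := [/\ phi z i = 0, phi z (i + 1) = 1 & phi z (i + 2) = -1].
have [n Dn] : exists n, base 0 n.
  have [|n Dn] := @phi_surj (fun i => if i == 0 then 0 else if i == 1 then 1 else -1).
    by rewrite sum_I3 /= add0r subrr.
  by exists n; split; rewrite Dn.
have rot i : exists2 u, u \in G & u origin = origin /\ base i (u n).
  have [r Gr Dr] := rotation_mem.
  have ro : r origin = origin.
    apply: phi_inj => k; rewrite -[k](subrK 1) Dr !phi_origin s0 //.
  have base_r k z : base k z -> base (k + 1) (r z).
    case=> z0 z1 z2; split; first by rewrite Dr z0 s0.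
      by rewrite Dr z1 s1.
    by rewrite addrAC Dr z2 sN s1.
  have base1 : base 1 (r n) by rewrite -[1]add0r; apply: base_r.
  elim/I3_ind: i.
  - by exists 1%g; rewrite ?group1 ?perm1.
  - by exists r.
  exists (r * r)%g; rewrite ?groupM // !permM !ro; split=> //.
  by rewrite (_ : 2 = 1 + 1) //; apply: base_r.
exists n => x x' /LSGP[ne_x [i Ei]].
have Ephi : phi x' i = phi x i by rewrite /phi Ei.
pose a := phi x' (i + 1) - phi x (i + 1).
have a_neq0 : a != 0.
  rewrite subr_eq0; apply/eqP=> /(can_inj eK) Ej; apply: ne_x.
  by apply: (@coord_inj _ i (i + 1)) => //; elim/I3_ind: (i).
have [r Gr [ro [rn0 rn1 rn2]]] := rot i.
have [m Gm Dm] := scaling_mem a_neq0.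
have [t Gt Dt] := translation_mem (phi_sum x).
exists (r * m * t)%g; first by rewrite !groupM.
rewrite !permM ro; split.
  by apply: phi_inj => k; rewrite Dt Dm phi_origin mulr0 add0r.
have phi_coord y y' k : phi y k = phi y' k -> coord y k = coord y' k by apply: (can_inj eK).
apply: (@coord_inj _ i (i + 1)); first by elim/I3_ind: (i).
  by apply: phi_coord; rewrite Dt Dm rn0 mulr0 add0r Ephi.
by apply: phi_coord; rewrite Dt Dm rn1 mulr1 subrK.
Qed.

Lemma fibre_arc_transitive : arc_transitive (@LSG gT) G.
Proof.
have [n bn] := arc_from_origin => x x' z z' /bn[u Gu [ux ux']] /bn[v Gv [vz vz']].
exists (u^-1 * v)%g; first by rewrite groupM ?groupV.
by rewrite !permM -ux -ux' !permK.
Qed.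

(** This normal subgroup yields the nontrivial complete quotient: it contains the translation by w
    and cannot leave a coset of the line. *)
Definition fibre_kernel : {set {perm V}} :=
  [set u in G | [forall x : V, proj (val (u x)) == proj (val x)]].

Lemma fibre_kernelP u : reflect (u \in G /\ forall x : V, proj (val (u x)) = proj (val x))
  (u \in fibre_kernel).
Proof.
rewrite [in X in reflect _ X]in_set; apply: (iffP andP) => -[Gu Pu]; split=> //.
  by move=> x; apply/eqP; apply: (forallP Pu).
by apply/forallP=> x; rewrite Pu.
Qed.

Lemma fibre_kernel_set : group_set fibre_kernel.
Proof.
apply/group_setP; split=> [|u v /fibre_kernelP[Gu Pu] /fibre_kernelP[Gv Pv]].
  by apply/fibre_kernelP; split=> [|x]; rewrite ?group1 ?perm1.
by apply/fibre_kernelP; split=> [|x]; rewrite ?groupM // permM Pv Pu.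
Qed.
Canonical fibre_kernel_group := Group fibre_kernel_set.

Lemma fibre_kernel_normal : fibre_kernel_group <| G.
Proof.
apply/andP; split; first by apply/subsetP=> u /fibre_kernelP[].
apply/subsetP=> v Gv; rewrite inE; apply/subsetP=> _ /imsetP[u /fibre_kernelP[Gu Pu] ->].
apply/fibre_kernelP; split=> [|x]; first by rewrite groupJ.
rewrite /conjg !permM -[in RHS](permKV v x).
by apply: fibre_group_proj Gv _; apply: Pu.
Qed.

Lemma fibre_kernel_neq1 : fibre_kernel_group :!=: 1%g.
Proof.
have [_ _ _ w0 [wnz _]] := line; have [|u Gu Du] := @translation_mem w; first by rewrite sum_I3.
apply/trivgPn; exists u.
  apply/fibre_kernelP; split=> // x; rewrite !projE !Du; ring.
apply: contraNneq wnz => u1; have := Du origin 0.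
by rewrite u1 perm1 phi_origin add0r => <-.
Qed.

Lemma fibre_kernel_intransitive :
  ~~ [transitive fibre_kernel_group, on [set: V] | 'P].
Proof.
have [_ _ _ w0 [wnz _]] := line.
apply/negP=> /atransP2 tr.
have [|n Dn] := @phi_surj (fun i => if i == 0 then 0 else if i == 1 then 1 else -1).
  by rewrite sum_I3 /= add0r subrr.
have [u /fibre_kernelP[_ Pu] Du] := tr origin n (in_setT _) (in_setT _).
have := Pu origin; rewrite -[u origin]/('P%act origin u) -Du !projE !Dn !phi_origin /=.
by move/eqP; rewrite !mulr0 mulr1 sub0r subr0 oppr_eq0 (negPf wnz).
Qed.

Lemma fibre_quotient_complete (p d : nat) : prime p -> (0 < d)%N -> #|gT| = (p ^ d)%N ->
  quotient_complete (@LSG gT) G.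
Proof.
move=> pr_p d_gt0 cG; have coordG u : u \in G -> exists f s, coordwise u f s.
  exact: induced_coordwise fibre_group_sub.
have complete (N : {group {perm V}}) : N <| G -> N :!=: 1%g -> complete_quotient (@LSG gT) N.
  by move=> nN ntN; apply: (normal_quotient_complete coordG fibre_arc_transitive pr_p cG d_gt0 nN ntN).
split=> [N nN ntN|]; first by left; apply: complete.
exists fibre_kernel_group; split; [exact: fibre_kernel_normal | exact: fibre_kernel_neq1 |
  exact: fibre_kernel_intransitive |].
by apply: complete; [exact: fibre_kernel_normal | exact: fibre_kernel_neq1].
Qed.

End Construction.

(** * Assembly of the three statements *)

Lemma is_Cp_power_abelem (gT : finGroupType) p d : prime p -> is_Cp_power gT p d ->
  p.-abelem [set: gT] /\ #|gT| = (p ^ d)%N.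
Proof.
move=> pr_p iso; split; first by rewrite (isog_abelem iso) mx_Fp_abelem.
by rewrite -cardsT (card_isog iso) cardsT card_mx mul1n card_Fp.
Qed.

Lemma abelem_is_Cp_power (gT : finGroupType) p d : prime p -> p.-abelem [set: gT] ->
  #|gT| = (p ^ d)%N -> is_Cp_power gT p d.
Proof.
move=> pr_p abG cG; rewrite /is_Cp_power (isog_abelem_card _ abG).
by rewrite mx_Fp_abelem //= !cardsT card_mx mul1n card_Fp // cG.
Qed.

Lemma arithmetic_conditionP p d : reflect (arithmetic_condition p d)
  [|| p != 2 %[mod 3], ~~ odd d | 3 %| d].
Proof.
apply: (iffP or3P) => -[H|H|H].
- by constructor 1; apply/eqP.
- by constructor 2.
- by constructor 3; apply/eqP.
- by constructor 1; apply/eqP.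
- by constructor 2.
by constructor 3; apply/eqP.
Qed.

Lemma arc_transitive_quasiprimitive (gT : finGroupType) p d : prime p -> (0 < d)%N ->
    is_Cp_power gT p d -> ~ arithmetic_condition p d ->
  forall G : {group {perm 3.-tuple gT}}, G \subset autoparatopism gT ->
    arc_transitive (@LSG gT) (induced_group G) ->
  vertex_quasiprimitive (induced_group G).
Proof.
move=> pr_p d_gt0 iso narith G sGA arcG N nNG ntN.
have [abG cG] := is_Cp_power_abelem pr_p iso.
move/arithmetic_conditionP: narith; rewrite !negb_or !negbK => /and3P[/eqP p2 odd_d d3].
by apply: (normal_transitive (fun u => @induced_coordwise gT G u sGA) arcG pr_p abG cG d_gt0 p2 odd_d d3 nNG ntN).
Qed.

(** The graph of the trivial group has a single vertex. This rules out the case where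
    arc-transitivity is vacuous. *)
Lemma cell_gt1 (gT : finGroupType) (N : {group {perm cell gT}}) :
  N :!=: 1 -> (1 < #|gT|)%N.
Proof.
apply: contraNltn => le1; rewrite -subG1; apply/subsetP=> u _.
apply/set1gP/permP=> x; apply: coord_ext => i.
by apply: (card_le1_eqP le1).
Qed.

Lemma exists_quotient_complete (gT : finGroupType) p d : prime p -> (0 < d)%N ->
    is_Cp_power gT p d -> arithmetic_condition p d ->
  exists G : {group {perm 3.-tuple gT}}, [/\ G \subset autoparatopism gT,
    arc_transitive (@LSG gT) (induced_group G) &
    quotient_complete (@LSG gT) (induced_group G)].
Proof.
move=> pr_p d_gt0 iso arith; have [abG cG] := is_Cp_power_abelem pr_p iso.
have [F [cF [sg [w [c line]]]]] := exists_shift_stable_line pr_p d_gt0 arith.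
(* H and the additive group of F are elementary abelian of the same order. *)
have : [set: gT] \isog [set: F].
  rewrite (isog_abelem_card _ abG) !cardsT cF cG eqxx andbT.
  exact: fin_ring_pchar_abelem (card_finPcharP cF pr_p).
case/isogP=> e /injmP inj_e _.
have e_inj : injective e by move=> a b; apply: inj_e; rewrite inE.
have leFG : (#|F| <= #|gT|)%N by rewrite cF cG.
have [g eK gK] := inj_card_bij e_inj leFG.
have eM a b : e (a * b) = (e a + e b)%R by rewrite morphM ?inE.
exists (fibre_group_group e w); split; first exact: fibre_group_sub.
- exact: (fibre_arc_transitive eK gK eM line).
exact: (fibre_quotient_complete eK gK eM line pr_p d_gt0 cG).
Qed.

Theorem theorem1p1 (gT : finGroupType) :
  [/\ (exists G : {group {perm 3.-tuple gT}},
         [/\ G \subset autoparatopism gT,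
             arc_transitive (@LSG gT) (induced_group G)
           & quotient_complete (@LSG gT) (induced_group G)]) ->
      exists p d : nat,
        [/\ prime p, (0 < d)%N, p.-abelem [set: gT], is_Cp_power gT p d
          & arithmetic_condition p d],
      forall p d : nat, prime p -> (0 < d)%N -> is_Cp_power gT p d ->
        ~ arithmetic_condition p d ->
        forall G : {group {perm 3.-tuple gT}},
          G \subset autoparatopism gT ->
          arc_transitive (@LSG gT) (induced_group G) ->
          vertex_quasiprimitive (induced_group G)
    & forall p d : nat, prime p -> (0 < d)%N -> is_Cp_power gT p d ->
        arithmetic_condition p d ->
        exists G : {group {perm 3.-tuple gT}},
          [/\ G \subset autoparatopism gT,
              arc_transitive (@LSG gT) (induced_group G)
            & quotient_complete (@LSG gT) (induced_group G)]].
Proof.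
split; [|exact: arc_transitive_quasiprimitive|exact: exists_quotient_complete].
case=> G [sGA arcG [_ [N [nNG ntN intrN _]]]].
have gT_gt1 := cell_gt1 ntN.
have [p pr_p abG] := arc_transitive_abelem (fun u => @induced_coordwise gT G u sGA) arcG gT_gt1.
have := abelem_pgroup abG; rewrite /pgroup cardsT => /p_natP[d cG].
have d_gt0 : (0 < d)%N by move: gT_gt1; rewrite cG; case: (d).
have iso := abelem_is_Cp_power pr_p abG cG.
(* If the condition failed, part (ii) would make the intransitive N transitive. *)
exists p, d; split=> //; apply/arithmetic_conditionP/negPn/negP=> /arithmetic_conditionP narith.
case/negP: intrN.
exact: (arc_transitive_quasiprimitive pr_p d_gt0 iso narith sGA arcG nNG ntN).
Qed.
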